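(* Let $n\ge2$. For every integer $k\ge0$ and every $\mathbf{q}\in\mathcal{P}_n$ the following integral relation (an analogue of an integral relation for Jacobi polynomials) holds: $$\mathbf{P}_k(x)\mathbf{q}(\mathbf{w})=Q(x)^{-1}\,\tilde Y(x)\int_{-1}^x\tilde Y(t)^{-1}\,\tilde{\mathbf{P}}_{k+1}(t)\mathbf{q}\left(\tilde Y(t)\tilde Y(x)^{-1}\mathbf{w}\right)dt,$$ or, in differential form, $$\partial_x(\mathbf{P}_k\mathbf{q})+\mathrm{d}_{\mathbf{w}}(\mathbf{P}_k\mathbf{q})\,M\mathbf{w}-M\,\mathbf{P}_k\mathbf{q}=Q^{-1}\,\tilde{\mathbf{P}}_{k+1}\mathbf{q},$$ or, in operator notation, $$\left(xD_1+D_2+Q\,\partial_x\right)\mathbf{P}_k=\tilde{\mathbf{P}}_{k+1}.$$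
   Context: Let $d\ge1$ and let $A,B$ be $d\times d$ complex matrices such that (i) $A+B$ is diagonalizable, and (ii) (nonresonance) the eigenvalues $\lambda_1,\dots,\lambda_d$ of $A+B$ (listed with multiplicity), with $\boldsymbol{\lambda}=(\lambda_1,\dots,\lambda_d)$, satisfy $\mathbf{m}\cdot\boldsymbol{\lambda}-\lambda_j\notin\mathbb{Z}_-=\{-1,-2,-3,\dots\}$ for all $\mathbf{m}\in\mathbb{N}^d$ and $j=1,\dots,d$, where $\mathbb{N}=\{0,1,2,\dots\}$. Put $M(x)=\frac{1}{x-1}A+\frac{1}{x+1}B$, $M_1=A+B$, $M_2=A-B$, $Q(x)=x^2-1$, so $QM=xM_1+M_2$. Let $Y$ be a fundamental matrix of solutions of $\mathbf{y}'=M\mathbf{y}$ (so $Y'=MY$, $Y$ invertible), taken locally near a point $x\in\mathbb{C}\setminus\{\pm1\}$ and, in integrals, continued along the path of integration. Let $\mathcal{P}_n$ be the space of $\mathbb{C}^d$-valued polynomials $\mathbf{q}(\mathbf{w})$ in $\mathbf{w}=(w_1,\dots,w_d)$ that are homogeneous of degree $n$. For $k\ge0$ the linear operator $\mathbf{P}_k(x)$ on $\mathcal{P}_n$ is defined by $$\mathbf{P}_k(x)\mathbf{q}(\mathbf{w})=Y(x)\,\frac{d^k}{dt^k}\Big|_{t=x}\left[Q(t)^k\,Y^{-1}(t)\,\mathbf{q}\left(Y(t)Y^{-1}(x)\mathbf{w}\right)\right];$$ it is a polynomial in $x$ with coefficients linear operators on $\mathcal{P}_n$. Define linear operators $D_1,D_2$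 on $\mathcal{P}_n$ by $D_i\mathbf{q}(\mathbf{w})=\mathrm{d}\mathbf{q}(\mathbf{w})\,M_i\mathbf{w}-M_i\mathbf{q}(\mathbf{w})$, where $\mathrm{d}\mathbf{q}(\mathbf{w})=\mathrm{d}_{\mathbf{w}}\mathbf{q}$ is the Jacobian matrix in $\mathbf{w}$; on functions of $(x,\mathbf{w})$ they act in $\mathbf{w}$ for fixed $x$. The operator identity is understood as applied to every $\mathbf{q}\in\mathcal{P}_n$ (constant in $x$). Let $\tilde M=M-\frac{2x}{(n-1)Q}\,I$, let $\tilde Y$ be a fundamental matrix with $\tilde Y'=\tilde M\tilde Y$ (continued along the path of integration in the same way), and let $\tilde{\mathbf{P}}_k(x)$ be the operators on $\mathcal{P}_n$ defined by the same formula as $\mathbf{P}_k(x)$ with $Y$ replaced by $\tilde Y$. In the integral relation, $\tilde{\mathbf{P}}_{k+1}(t)\mathbf{q}(\tilde Y(t)\tilde Y(x)^{-1}\mathbf{w})$ denotes the polynomial $\tilde{\mathbf{P}}_{k+1}(t)\mathbf{q}\in\mathcal{P}_n$ evaluated at the point $\tilde Y(t)\tilde Y(x)^{-1}\mathbf{w}$.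
   Formalization: The integral relation is stated literally if Re(m·μ−μ_j)>0 for all |m|=n and j (μ the eigenvalues of B), otherwise by analytic continuation in e of B+eI, as for general B the integral diverges or leaves a boundary term; paths are C¹ and leave −1 with nonzero velocity. *)

(* Defs.v *)
From HB Require Import structures.
From mathcomp Require Import all_boot all_order all_algebra.
From mathcomp Require Import complex.
From mathcomp Require Import all_classical all_reals all_analysis.
(* Not imported: its notations clash with those of mathcomp-analysis. *)
From mathcomp Require mpoly.

Set Implicit Arguments.
Unset Strict Implicit.
Unset Printing Implicit Defensive.

Import Order.TTheory GRing.Theory Num.Theory.
Import numFieldNormedType.Exports.

Local Open Scope classical_set_scope.
Local Open Scope ring_scope.
Local Open Scope complex_scope.

(* numFieldNormedType only covers abstract fields: give the concrete field
   R[i] the same normed-space structure over itself. *)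
HB.instance Definition _ (R : rcfType) := NormedModule.copy R[i] R[i]^o.

Section Setting.
Context {R : realType} {d : nat}.
Local Notation C := R[i].
Implicit Types (A B : 'M[C]_d).

(* lam lists the eigenvalues of A with multiplicity. *)
Definition eigenvalues_of A (lam : 'I_d -> C) : Prop :=
  char_poly A = \prod_(i < d) ('X - (lam i)%:P).

Definition nonresonant (lam : 'I_d -> C) : Prop :=
  forall (m : 'I_d -> nat) (j : 'I_d) (p : nat),
    \sum_(i < d) (m i)%:R * lam i - lam j <> - p.+1%:R.

Definition Qpol (x : C) : C := x ^+ 2 - 1.

Definition Msys A B (x : C) : 'M[C]_d := (x - 1)^-1 *: A + (x + 1)^-1 *: B.

Definition Mtilde A B (n : nat) (x : C) : 'M[C]_d :=
  Msys A B x - (2%:R * x / ((n%:R - 1) * Qpol x))%:M.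

(* Y is a fundamental matrix of y' = M y on a neighbourhood of x, the
   derivative being the complex one. *)
Definition fundamental_near (M : C -> 'M[C]_d) (x : C) (Y : C -> 'M[C]_d) :
    Prop :=
  \forall z \near x, Y z \in unitmx /\ is_derive z 1 Y (M z *m Y z).

(* A C^d-valued polynomial, homogeneous of degree n in d variables, is given by
   its d components; Peval is the corresponding map on column vectors. *)
Definition Pspace (n : nat) : Type := 'I_d -> mpoly.dhomog d C n.

Definition Peval n (q : Pspace n) (w : 'cV[C]_d) : 'cV[C]_d :=
  \col_i mpoly.meval (fun j => w j 0) (mpoly.mpoly_of_dhomog (q i)).

(* The value at w of P_k(x) q. Only the germ of Y at x matters. *)
Definition Pop (Y : C -> 'M[C]_d) (k : nat) (x : C)
    (q : 'cV[C]_d -> 'cV[C]_d) (w : 'cV[C]_d) : 'cV[C]_d :=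
  Y x *m derive1n k (fun t : C =>
    Qpol t ^+ k *: (invmx (Y t) *m q (Y t *m invmx (Y x) *m w))) x.

(* D_i is Dop M_i, with the Jacobian read as the differential in w. *)
Definition Dop (M0 : 'M[C]_d) (f : 'cV[C]_d -> 'cV[C]_d) (w : 'cV[C]_d) :
    'cV[C]_d :=
  'd f w (M0 *m w) - M0 *m f w.

Definition velocity (g : R -> C) (s : R) : C :=
  derive1 (fun t => complex.Re (g t)) s
  +i* derive1 (fun t => complex.Im (g t)) s.

(* C^1 paths s in [0, 1] |-> g s from -1 to x that avoid 1 and -1 for s > 0.
   Regularity is asked on the whole line for simplicity: every C^1 path on
   [0, 1] extends. The nonzero initial velocity excludes paths that spiral
   into the singular point -1. *)
Definition path_from_m1 (g : R -> C) (x : C) : Prop :=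
  [/\ g 0 = -1, g 1 = x,
      forall s : R, 0 < s <= 1 -> g s != 1 /\ g s != -1,
      (forall s : R, derivable (fun t => complex.Re (g t)) s 1 /\
                     derivable (fun t => complex.Im (g t)) s 1) /\
      continuous (velocity g)
    & velocity g 0 != 0].

(* Analytic continuation along g of a fundamental matrix: Y s is the germ at
   g s, and germs at nearby parameters agree. *)
Definition continued_along (M : C -> 'M[C]_d) (g : R -> C)
    (Y : R -> C -> 'M[C]_d) : Prop :=
  forall s : R, 0 < s <= 1 ->
    fundamental_near M (g s) (Y s) /\
    \forall s' \near s, 0 < s' <= 1 -> \forall z \near g s', Y s' z = Y s z.

(* Y(t)^-1 P_l(t) q (Y(t) Y(x)^-1 w) dt, pulled back by t = g s, x = g 1. *)
Definition integrand (Y : R -> C -> 'M[C]_d) (g : R -> C) (l : nat)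
    (q : 'cV[C]_d -> 'cV[C]_d) (w : 'cV[C]_d) (s : R) : 'cV[C]_d :=
  velocity g s *: (invmx (Y s (g s)) *m
    Pop (Y s) l (g s) q (Y s (g s) *m invmx (Y 1 (g 1)) *m w)).

Definition integrable01 (F : R -> 'cV[C]_d) : Prop :=
  forall i : 'I_d,
    lebesgue_measure.-integrable `]0, 1]
      (EFin \o (fun s => complex.Re (F s i 0))) /\
    lebesgue_measure.-integrable `]0, 1]
      (EFin \o (fun s => complex.Im (F s i 0))).

Definition integral01 (F : R -> 'cV[C]_d) : 'cV[C]_d :=
  \col_i ((\int[lebesgue_measure]_(s in `]0, 1]) complex.Re (F s i 0))
          +i* (\int[lebesgue_measure]_(s in `]0, 1]) complex.Im (F s i 0))).

(* The right-hand side of the integral relation along g exists and equals v. *)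
Definition integral_rhs (Y : R -> C -> 'M[C]_d) (g : R -> C) (k : nat)
    (q : 'cV[C]_d -> 'cV[C]_d) (w v : 'cV[C]_d) : Prop :=
  integrable01 (integrand Y g k.+1 q w) /\
  v = (Qpol (g 1))^-1 *: (Y 1 (g 1) *m integral01 (integrand Y g k.+1 q w)).

(* The integrals converge for all q when the exponents m.mu - mu_j, |m| = n, of
   Y^-1 q(Y w) at -1 have positive real part; for d = 1 this is the usual
   condition beta > -1 on the weight (1 - t)^alpha (1 + t)^beta of the
   integrand. *)
Definition convergent_at_m1 (n : nat) B : Prop :=
  exists mu : 'I_d -> C, eigenvalues_of B mu /\
    forall (m : 'I_d -> nat) (j : 'I_d), (\sum_(i < d) m i = n)%N ->
      0 < complex.Re (\sum_(i < d) (m i)%:R * mu i - mu j).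

(* For arbitrary B the integral from -1 is understood, as for Jacobi
   polynomials with general parameters, by analytic continuation: B + e I gives
   convergent integrals when Re e is large, and v is the value at e = 0 of the
   entire function of e that they define. *)
Definition continued_integral_rhs A B (n : nat) (g : R -> C) (k : nat)
    (q : 'cV[C]_d -> 'cV[C]_d) (w v : 'cV[C]_d) : Prop :=
  exists f : C -> 'cV[C]_d,
    [/\ forall e : C, derivable f e 1,
        exists c : R, forall (e : C) (Y : R -> C -> 'M[C]_d),
          c < complex.Re e -> continued_along (Mtilde A (B + e%:M) n) g Y ->
          integral_rhs Y g k q w (f e)
      & f 0 = v].

End Setting.

(* Main.v *)
Require Import Defs.
From HB Require Import structures.
From mathcomp Require Import all_boot all_order all_algebra.
From mathcomp Require Import complex ring lra.
From mathcomp Require Import all_classical all_reals all_analysis measurable_realfun.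
From mathcomp Require Import -(notations) mpoly.
Set Implicit Arguments.
Unset Strict Implicit.
Unset Printing Implicit Defensive.
Import Order.TTheory GRing.Theory Num.Theory.
Import numFieldNormedType.Exports.
Local Open Scope classical_set_scope.
Local Open Scope ring_scope.
Local Open Scope complex_scope.

(** Write T for the pullback (T q)(x, v) = Y(x)^-1 q(Y(x) v), so that
    P_k = T^-1 d^k/dx^k (Q^k T).  As Y' = M Y and G = Q M is a polynomial in x,
    one differentiation sends Q^(c+1) T p to Q^c T p', where
    p' = 2 (c+1) x p + Q dp/dx + d_w p (G w) - G p is again a polynomial in x
    and w ([is_derive_pullback]).  Iterating, P_k q is given by a recursion on
    polynomials that mentions M but no fundamental matrix
    ([derive1n_rodrigues], [Pop_rodrigues]).

    The tilde system has Q M~ = G - 2 x / (n - 1) I.  On polynomials homogeneous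
    of degree n, Euler's identity turns this scalar into the extra term -2 x p,
    which lowers the constant c in the recursion by one ([step_shift]).  The
    k + 1 steps for P~_(k+1), with constants k + 1, ..., 1, are therefore the k
    steps for P_k, with constants k, ..., 1, followed by the step with constant
    0, and that last step is x D_1 + D_2 + Q d/dx ([Pop_Mtilde]).  This is the
    operator form; dividing by Q gives the differential form
    ([differential_relation]).

    In terms of the pullback by Y~, it says that the integrand of the integral
    relation is the derivative of Q Y~^-1 (P_k q)(Y~ v)
    ([primitive_cderiv]), and only the behaviour at -1 remains.  Along the path
    the tilde system is s y' = K(s) y with K(s) tending to B - I / (n - 1)
    ([residue_limit]).  A change of basis makes this residue almost diagonal,
    and a monotone energy then shows that a solution is O(s^alpha) for each
    alpha below the real parts of the eigenvalues ([system_growth]).  The same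
    applies to the inverse transpose of Y~, so if a <= Re mu <= b for the
    eigenvalues mu of B and n a > b, then Y~^-1 p(Y~ v) is O(s^beta) with
    beta > -1 for every p homogeneous of degree n ([pullback_bound]).  The
    integrand is thus integrable, the primitive vanishes at -1 and the
    fundamental theorem of calculus applies ([integral_along]).

    The convergence hypothesis gives n a > b ([convergent_gap]).  For arbitrary
    B, the recursion is run with a further variable e that replaces B by
    B + e I: its value is a polynomial in e, it satisfies the integral relation
    as soon as Re e is large ([shift_gap]), and it is P_k q at e = 0. *)

(** * Calculus of matrix-valued and polynomial functions *)

Section MatrixCalculus.
Context {K : numFieldType}.

Lemma cvg_mx (T : Type) (F : set_system T) {FF : Filter F} m p
    (f : T -> 'M[K]_(m, p)) (l : 'M[K]_(m, p)) :
  (forall i j, f x i j @[x --> F] --> l i j) -> f @ F --> l.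
Proof.
move=> fl A [P HP PA]; apply: (filterS PA).
apply: filter_forall => i; apply: filter_forall => j.
exact: fl (HP i j).
Qed.

Lemma cvg_mx_coord (T : Type) (F : set_system T) {FF : Filter F} m p
    (f : T -> 'M[K]_(m, p)) (l : 'M[K]_(m, p)) i j :
  f @ F --> l -> f x i j @[x --> F] --> l i j.
Proof.
move=> fl; have c := @coord_continuous K m p i j l.
have := @continuous_cvg _ _ _ F FF f (fun M : 'M[K]_(m, p) => M i j) l c fl.
exact.
Qed.

Context {V : normedModType K}.
Implicit Types (a v : V).

Lemma is_deriveP (W : normedModType K) (f : V -> W) a v df :
  is_derive a v f df <->
  (fun h : K => h^-1 *: (f (h *: v + a) - f a)) @ 0^' --> df.
Proof.
split=> [[fav <-]|fav]; first exact: fav.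
have df' : 'D_v f a = df by apply/cvg_lim.
by apply: DeriveDef => //; apply/cvg_ex; exists df.
Qed.

Lemma is_derive_mxP m p (f : V -> 'M[K]_(m, p)) a v df :
  is_derive a v f df <->
  forall i j, is_derive a v (fun x => f x i j) (df i j).
Proof.
have quotE i j : (fun h : K => (h^-1 *: (f (h *: v + a) - f a)) i j) =
    (fun h => h^-1 *: (f (h *: v + a) i j - f a i j)).
  by apply/funext => h; rewrite !mxE.
split=> [/is_deriveP fav i j|fav].
  by apply/is_deriveP; rewrite -quotE; exact: cvg_mx_coord fav.
apply/is_deriveP; apply: cvg_mx => i j; rewrite quotE.
by apply/is_deriveP; exact: fav.
Qed.

Lemma is_derive_sumf (W : normedModType K) (I : Type) (r : seq I)
    (h : I -> V -> W) a v dh :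
  (forall i, is_derive a v (h i) (dh i)) ->
  is_derive a v (fun x => \sum_(i <- r) h i x) (\sum_(i <- r) dh i).
Proof.
move=> hd; elim: r => [|i r IH].
  under eq_fun do rewrite big_nil; rewrite big_nil; exact: is_derive_cst.
under eq_fun do rewrite big_cons; rewrite big_cons; exact: is_deriveD.
Qed.

Lemma is_derive_mulmx m p q (f : V -> 'M[K]_(m, p)) (g : V -> 'M[K]_(p, q))
    a v df dg :
  is_derive a v f df -> is_derive a v g dg ->
  is_derive a v (fun x => f x *m g x) (df *m g a + f a *m dg).
Proof.
move=> /is_derive_mxP fd /is_derive_mxP gd; apply/is_derive_mxP => i j.
under eq_fun do rewrite mxE.
have := @is_derive_sumf _ _ (index_enum 'I_p) (fun k x => f x i k * g x k j) a v
  (fun k => f a i k * dg k j + g a k j * df i k).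
move=> /(_ (fun k => @is_deriveM _ _ _ _ a v _ _ (fd i k) (gd k j))) H.
apply: is_derive_eq H _; rewrite !mxE -big_split /=; apply: eq_bigr => k _.
by rewrite addrC [df _ _ * _]mulrC.
Qed.

Lemma is_derive_scale_mx m p (c : V -> K) (f : V -> 'M[K]_(m, p)) a v dc df :
  is_derive a v c dc -> is_derive a v f df ->
  is_derive a v (fun x => c x *: f x) (dc *: f a + c a *: df).
Proof.
move=> cd /is_derive_mxP fd; apply/is_derive_mxP => i j.
have -> : (fun x => (c x *: f x) i j) = (c * (fun x => f x i j)).
  by apply/funext => x; rewrite mxE.
apply: is_derive_eq (is_deriveM cd (fd i j)) _.
by rewrite !mxE /GRing.scale /= addrC [dc * _]mulrC.
Qed.

Lemma derivable_prodf (I : Type) (r : seq I) (h : I -> V -> K) a v :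
  (forall i, derivable (h i) a v) ->
  derivable (fun x => \prod_(i <- r) h i x) a v.
Proof.
move=> hd; elim: r => [|i r IH].
  under eq_fun do rewrite big_nil; exact: derivable_cst.
under eq_fun do rewrite big_cons; exact: derivableM.
Qed.

Lemma derivable_det m (f : V -> 'M[K]_m) a v :
  (forall i j, derivable (fun x => f x i j) a v) ->
  derivable (fun x => \det (f x)) a v.
Proof.
move=> fd; rewrite /determinant.
apply: (@ex_derive _ _ _ _ _ _ _ (is_derive_sumf _ _)) => s.
apply/derivableP/derivableM; first exact: derivable_cst.
exact: derivable_prodf.
Qed.

(** Cramer's formula makes the inverse derivable; its derivative is then forced
    by the product rule applied to the identity it satisfies. *)
Lemma is_derive_invmx m (f : V -> 'M[K]_m) a v df :
  (\forall x \near a, f x \in unitmx) -> is_derive a v f df ->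
  is_derive a v (fun x => invmx (f x)) (- (invmx (f a) *m df *m invmx (f a))).
Proof.
move=> fu fd; have fua := nbhs_singleton fu.
have fdij i j : derivable (fun x => f x i j) a v.
  by have /is_derive_mxP /(_ i j) [] := fd.
have Df : derivable (fun x => \det (f x)) a v by exact: derivable_det.
have invd : is_derive a v (fun x => invmx (f x)) ('D_v (fun x => invmx (f x)) a).
  apply/derivableP; pose adj x := (\det (f x))^-1 *: \adj (f x).
  apply: (@near_eq_derivable _ _ _ adj).
    by near=> x; rewrite /adj /invmx (near fu x).
  suff [] : is_derive a v adj (\matrix_(i, j) 'D_v (fun x => adj x i j) a) by [].
  apply/is_derive_mxP => i j; rewrite mxE; apply/derivableP.
  rewrite /adj; under eq_fun do rewrite !mxE.
  apply: derivableM.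
    by apply: derivableV => //; rewrite -unitfE -unitmxE.
  rewrite /cofactor; apply: derivableM; first exact: derivable_cst.
  apply: derivable_det => k l; under eq_fun do rewrite !mxE.
  exact: fdij.
have idd := is_derive_mulmx invd fd.
have idc : is_derive a v (fun x => invmx (f x) *m f x) 0.
  apply: near_eq_is_derive (is_derive_cst (1%:M : 'M[K]_m) a v).
  by near=> x; rewrite mulVmx//; near: x.
apply: is_derive_eq invd _.
have /eqP := etrans (esym (@derive_val _ _ _ _ _ _ _ idd)) (@derive_val _ _ _ _ _ _ _ idc).
rewrite addr_eq0 => /eqP /(congr1 (mulmx^~ (invmx (f a)))).
by rewrite mulmxK// mulNmx.
Unshelve. all: by end_near. Qed.

End MatrixCalculus.

Section PolynomialFunctions.
Context {K : numFieldType} {N : nat}.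
Implicit Types (p : mpoly N K) (i : 'I_N).

Local Notation "'X_ i" := (mpolyX K (mnm1 i)) (at level 8, i at level 2).

Lemma mpoly_ring_ind (P : mpoly N K -> Prop) :
  (forall c, P (mpolyC N c)) -> (forall i, P 'X_i) ->
  (forall p r, P p -> P r -> P (p + r)) ->
  (forall p r, P p -> P r -> P (p * r)) -> forall p, P p.
Proof.
move=> PC PX PD PM p; have P1 : P 1 by rewrite -mpolyC1.
elim/mpolyind: p => [|c m p _ _ Pp]; first by rewrite -mpolyC0.
apply: (PD) => //; rewrite -mul_mpolyC; apply: (PM) => //.
rewrite mpolyXE_id; apply: big_ind => [//|r s|i _]; first exact: PM.
by elim: (m i) => [|k IH]; rewrite ?expr0// exprS; exact: PM.
Qed.

(** Both sides are compatible with sums and products, so constants and variables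
    suffice. *)
Lemma is_derive_meval (V : normedModType K) (g : V -> 'I_N -> K)
    (dg : 'I_N -> K) (a v : V) p :
  (forall i, is_derive a v (fun x => g x i) (dg i)) ->
  is_derive a v (fun x => meval (g x) p)
    (\sum_i dg i * meval (g a) (mderiv i p)).
Proof.
move=> gd; elim/mpoly_ring_ind: p => [c|i|p r IHp IHr|p r IHp IHr].
- under eq_fun do rewrite mevalC.
  apply: is_derive_eq (is_derive_cst _ _ _) _.
  by rewrite big1// => i _; rewrite mderivC meval0 mulr0.
- under eq_fun do rewrite mevalXU; apply: is_derive_eq (gd i) _.
  rewrite (bigD1 i)//= big1 ?addr0 => [|j ji].
    rewrite mderivX mnm1E eqxx scale1r mevalX big1 ?mulr1// => k _.
    by rewrite mnmBE subnn expr0.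
  by rewrite mderivX mnm1E eq_sym (negbTE ji) scale0r meval0 mulr0.
- under eq_fun do rewrite mevalD.
  apply: is_derive_eq (is_deriveD IHp IHr) _.
  by rewrite -big_split; apply: eq_bigr => i _ /=; rewrite mderivD mevalD mulrDr.
- under eq_fun do rewrite mevalM.
  apply: is_derive_eq (is_deriveM IHp IHr) _.
  rewrite !scaler_sumr -big_split; apply: eq_bigr => i _ /=.
  by rewrite mderivM mevalD !mevalM /GRing.scale /=; ring.
Qed.

Lemma differentiable_meval (V : normedModType K) (g : V -> 'I_N -> K)
    (a : V) p :
  (forall i, differentiable (fun x => g x i) a) ->
  differentiable (fun x => meval (g x) p) a.
Proof.
move=> gl; elim/mpoly_ring_ind: p => [c|i|p r IHp IHr|p r IHp IHr].
- by under eq_fun do rewrite mevalC; exact: differentiable_cst.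
- by under eq_fun do rewrite mevalXU.
- by under eq_fun do rewrite mevalD; exact: differentiableD.
- by under eq_fun do rewrite mevalM; exact: differentiableM.
Qed.

Lemma bounded_meval (r : K) p :
  exists2 C : K, 0 <= C &
    forall v : 'I_N -> K, (forall i, `|v i| <= r) -> `|meval v p| <= C.
Proof.
elim/mpoly_ring_ind: p => [c|i|p s [C C0 HC] [D D0 HD]|p s [C C0 HC] [D D0 HD]].
- by exists `|c| => // v _; rewrite mevalC.
- exists `|r| => // v vr; rewrite mevalXU.
  by rewrite [`|r|]ger0_norm ?vr//; exact: le_trans (normr_ge0 _) (vr i).
- exists (C + D) => [|v vr]; first exact: addr_ge0.
  by rewrite mevalD (le_trans (ler_normD _ _))// lerD ?HC ?HD.
- exists (C * D) => [|v vr]; first exact: mulr_ge0.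
  by rewrite mevalM normrM ler_pM ?HC ?HD.
Qed.

(** A partial derivative is the derivative along a coordinate line, which only
    involves values. *)
Lemma mderiv_meval_eq p r i :
  (forall v, meval v p = meval v r) ->
  forall v, meval v (mderiv i p) = meval v (mderiv i r).
Proof.
move=> pr v.
pose g (t : K) (j : 'I_N) := v j + t * (j == i)%:R.
have gd j : is_derive (0 : K) (1 : K) (g ^~ j) (j == i)%:R.
  apply: is_derive_eq; rewrite /GRing.scale /= ; ring.
have dE s : is_derive (0 : K) (1 : K) (fun t => meval (g t) s)
    (meval v (mderiv i s)).
  apply: is_derive_eq (is_derive_meval s gd) _.
  rewrite (bigD1 i)//= eqxx mul1r big1 ?addr0 => [|j /negbTE->]; last by rewrite mul0r.
  by apply: meval_eq => j; rewrite /g mul0r addr0.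
rewrite -(@derive_val _ _ _ _ _ _ _ (dE p)) -(@derive_val _ _ _ _ _ _ _ (dE r)).
by under eq_fun do rewrite pr.
Qed.

End PolynomialFunctions.

(** * The Rodrigues formula as a recursion on polynomials *)

Section RodriguesPolynomials.
Context {K : numFieldType} {d : nat}.
Local Notation poly := (mpoly (2 + d) K).
Local Notation "'X_ i" := (mpolyX K (mnm1 i)) (at level 8, i at level 2).
Implicit Types (p : 'cV[poly]_d) (G : 'M[poly]_d) (x e : K) (w u : 'cV[K]_d).

(** Besides x and w there is a variable e, which stands for the multiple of the
    identity that is added to B. *)
Definition xindex : 'I_(2 + d) := lshift d 0.
Definition eindex : 'I_(2 + d) := lshift d 1.
Definition windex (l : 'I_d) : 'I_(2 + d) := rshift 2 l.

Definition point x e w : 'I_(2 + d) -> K :=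
  fun i => match fintype.split i with
           | inl i0 => if i0 == 0 then x else e
           | inr l => w l 0
           end.

Lemma point_lshift x e w k :
  point x e w (lshift d k) = if k == 0 then x else e.
Proof. by rewrite /point (_ : fintype.split _ = inl k)//; exact: (unsplitK (inl k)). Qed.

Lemma pointx x e w : point x e w xindex = x.
Proof. exact: point_lshift. Qed.

Lemma pointe x e w : point x e w eindex = e.
Proof. exact: point_lshift. Qed.

Lemma pointw x e w l : point x e w (windex l) = w l 0.
Proof. by rewrite /point (_ : fintype.split _ = inr l)//; exact: (unsplitK (inr l)). Qed.

Definition evalmx m n (P : 'M[poly]_(m, n)) x e w : 'M[K]_(m, n) :=
  map_mx (meval (point x e w)) P.

Definition partial i p : 'cV[poly]_d := map_mx (mderiv i) p.

(** The differential in w at the point (x, e, w), applied to u. *)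
Definition wdiff p x e w u : 'cV[K]_d :=
  \sum_l u l 0 *: evalmx (partial (windex l) p) x e w.

Lemma wdiffD p x e w u u' : wdiff p x e w (u + u') = wdiff p x e w u + wdiff p x e w u'.
Proof. by rewrite -big_split; apply: eq_bigr => l _; rewrite mxE scalerDl. Qed.

Lemma wdiffZ p x e w c u : wdiff p x e w (c *: u) = c *: wdiff p x e w u.
Proof. by rewrite scaler_sumr; apply: eq_bigr => l _; rewrite mxE scalerA. Qed.

Lemma is_derive_evalmx (V : normedModType K) p (x e : V -> K) (w : V -> 'cV[K]_d)
    a v dx de dw :
  is_derive a v x dx -> is_derive a v e de -> is_derive a v w dw ->
  is_derive a v (fun t => evalmx p (x t) (e t) (w t))
    (dx *: evalmx (partial xindex p) (x a) (e a) (w a)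
     + de *: evalmx (partial eindex p) (x a) (e a) (w a)
     + wdiff p (x a) (e a) (w a) dw).
Proof.
move=> xd ed /is_derive_mxP wd; apply/is_derive_mxP => i j.
have pd k : is_derive a v (fun t => point (x t) (e t) (w t) k) (point dx de dw k).
  rewrite -[k]splitK; case: (fintype.split k) => [k0|l] /=; last first.
    rewrite -/(windex l) pointw (_ : (fun t => _) = fun t => w t l 0); first exact: wd.
    by apply/funext => t; rewrite pointw.
  rewrite point_lshift (_ : (fun t => _) = if k0 == 0 then x else e).
    by case: ifP.
  by apply/funext => t; rewrite point_lshift; case: ifP.
have H := is_derive_meval (p i j) pd.
rewrite (_ : (fun t => _) = fun t => meval (point (x t) (e t) (w t)) (p i j)); last first.
  by apply/funext => t; rewrite mxE.
apply: is_derive_eq H _.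
rewrite big_split_ord /= big_ord_recl big_ord1 /=.
rewrite !mxE summxE -/xindex pointx.
have -> : lshift d (lift ord0 ord0) = eindex by apply/val_inj.
rewrite pointe; congr (_ + _); apply: eq_bigr => l _.
by rewrite -/(windex l) pointw !mxE.
Qed.

Lemma wdiff0 p x e w : wdiff p x e w 0 = 0.
Proof. by rewrite /wdiff big1// => l _; rewrite mxE scale0r. Qed.

Lemma is_derive_evalmx_x p x e w :
  is_derive x 1 (fun t => evalmx p t e w) (evalmx (partial xindex p) x e w).
Proof.
apply: is_derive_eq (is_derive_evalmx p (is_derive_id x (1 : K))
  (is_derive_cst e x (1 : K)) (is_derive_cst w x (1 : K))) _.
by rewrite /cst scale1r scale0r addr0 wdiff0 addr0.
Qed.

Lemma is_derive_evalmx_e p x e w :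
  is_derive e 1 (fun t => evalmx p x t w) (evalmx (partial eindex p) x e w).
Proof.
apply: is_derive_eq (is_derive_evalmx p (is_derive_cst x e (1 : K))
  (is_derive_id e (1 : K)) (is_derive_cst w e (1 : K))) _.
by rewrite /cst scale1r scale0r add0r wdiff0 addr0.
Qed.

Lemma differentiable_evalmx p x e w : differentiable (evalmx p x e) w.
Proof.
rewrite (_ : evalmx p x e =
    \sum_i (fun u => meval (point x e u) (p i 0) *: delta_mx i 0)); last first.
  apply/funext => u; rewrite fct_sumE [LHS]matrix_sum_delta; apply: eq_bigr => i _.
  by rewrite big_ord1 mxE.
apply: differentiable_sum => i; apply: differentiableZl.
apply: differentiable_meval => k; rewrite -[k]splitK.
case: (fintype.split k) => [k0|l] /=.
  rewrite (_ : (fun u => _) = cst (if k0 == 0 then x else e)) //.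
  by apply/funext => t; rewrite point_lshift.
rewrite (_ : (fun u => _) = fun u : 'cV[K]_d => u l 0); first exact: differentiable_coord.
by apply/funext => t; rewrite -/(windex l) pointw.
Qed.

Lemma diff_evalmx p x e w u : 'd (evalmx p x e) w u = wdiff p x e w u.
Proof.
rewrite -deriveE; last exact: differentiable_evalmx.
have H := is_derive_evalmx p (is_derive_cst x w u) (is_derive_cst e w u) (is_derive_id w u).
rewrite (@derive_val _ _ _ _ _ _ _ H).
by rewrite !scale0r !add0r.
Qed.

(** Q^(1-c) Y d/dx (Q^c Y^-1 p(Y v)) at w = Y v, where G stands for Q M. *)
Definition rodrigues_step G (c : nat) p : 'cV[poly]_d :=
  (c.*2%:R * 'X_xindex) *: p + ('X_xindex ^+ 2 - 1) *: partial xindex p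
  + \sum_l (G *m (\col_i 'X_(windex i))) l 0 *: partial (windex l) p - G *m p.

(** Q^(j-k) Y d^j/dx^j (Q^k Y^-1 p(Y v)): the power of Q that is left goes down
    by one at each step. *)
Fixpoint rodrigues G (k : nat) p (j : nat) : 'cV[poly]_d :=
  if j is j'.+1 then rodrigues_step G (k - j') (rodrigues G k p j') else p.

Lemma rodrigues0 G k p : rodrigues G k p 0 = p.
Proof. by []. Qed.

Lemma rodriguesS G k p j :
  rodrigues G k p j.+1 = rodrigues_step G (k - j) (rodrigues G k p j).
Proof. by []. Qed.

Lemma evalmx_step G c p x e w :
  evalmx (rodrigues_step G c p) x e w =
  (c.*2%:R * x) *: evalmx p x e w
  + (x ^+ 2 - 1) *: evalmx (partial xindex p) x e w
  + wdiff p x e w (evalmx G x e w *m w)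
  - evalmx G x e w *m evalmx p x e w.
Proof.
rewrite /rodrigues_step /evalmx map_mxB map_mxM map_mxD map_mxD !map_mxZ map_mx_sum.
rewrite rmorphM rmorphB rmorphXn rmorph1 rmorph_nat /= !mevalXU !pointx.
congr (_ + _ - _); apply: eq_bigr => l _; rewrite map_mxZ; congr (_ *: _).
transitivity ((evalmx (G *m \col_i 'X_(windex i)) x e w) l 0).
  by rewrite [RHS]mxE.
rewrite /evalmx map_mxM; congr ((_ *m _) _ _).
by apply/matrixP => i j; rewrite !mxE /= mevalXU ord1 pointw.
Qed.

(** The recursion is the derivative of Q^(c+1) Y^-1 p(Y v): differentiating
    Q^(c+1) gives the first term, the curve (t, Y(t) v) the next two and Y^-1
    the last one. *)
Lemma is_derive_pullback G c p (M : 'M[K]_d) (Y : K -> 'M[K]_d) (t e : K) v :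
  (t ^+ 2 - 1) *: M = evalmx G t e (Y t *m v) ->
  (\forall s \near t, Y s \in unitmx) -> is_derive t 1 Y (M *m Y t) ->
  is_derive t 1
    (fun s => (s ^+ 2 - 1) ^+ c.+1 *: (invmx (Y s) *m evalmx p s e (Y s *m v)))
    ((t ^+ 2 - 1) ^+ c
     *: (invmx (Y t) *m evalmx (rodrigues_step G c.+1 p) t e (Y t *m v))).
Proof.
move=> GM Yu Yd; have Ytu := nbhs_singleton Yu.
have Yid := is_derive_invmx Yu Yd.
have vd := is_derive_mulmx Yd (is_derive_cst v t 1).
have pd := is_derive_evalmx p (is_derive_id t 1) (is_derive_cst e t 1) vd.
have Qd : is_derive t 1 (fun s : K => (s ^+ 2 - 1) ^+ c.+1)
    (c.+1.*2%:R * t * (t ^+ 2 - 1) ^+ c).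
  rewrite (_ : (fun s => _) = (id ^+ 2 - cst 1) ^+ c.+1); last first.
    by apply/funext => s; rewrite !exprfctE.
  apply: is_derive_eq; rewrite -muln2 natrM /GRing.scale /= !fctE /=.
  by rewrite expr1 subr0 !mulr1; ring.
apply: is_derive_eq (is_derive_scale_mx Qd (is_derive_mulmx Yid pd)) _.
rewrite /cst evalmx_step mulmx0 addr0 scale1r scale0r addr0 !mulmxA mulmxK//.
rewrite -GM -!scalemxAl wdiffZ mulNmx.
rewrite !(mulmxDr, mulmxN) -!scalemxAr !mulmxA.
move: (t ^+ 2 - 1) (c.+1.*2%:R * t) => q b; rewrite [q ^+ c.+1]exprSr.
move: (_ *m _) (_ *m _ *m _) (_ *m _) (_ *m wdiff _ _ _ _ _) => H MH HX W.
by apply/matrixP => i j; rewrite !mxE; ring.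
Qed.

(** For M = Y' Y^-1 and Q M = G, the Rodrigues formula only involves
    polynomials. *)
Lemma derive1n_rodrigues G k p (M Y : K -> 'M[K]_d) (x e : K) v :
  (\forall z \near x, (z ^+ 2 - 1) *: M z = evalmx G z e (Y z *m v)) ->
  (\forall z \near x, Y z \in unitmx /\ is_derive z 1 Y (M z *m Y z)) ->
  forall j, (j <= k)%N -> \forall t \near x,
    derive1n j (fun s => (s ^+ 2 - 1) ^+ k
                         *: (invmx (Y s) *m evalmx p s e (Y s *m v))) t =
    (t ^+ 2 - 1) ^+ (k - j)
    *: (invmx (Y t) *m evalmx (rodrigues G k p j) t e (Y t *m v)).
Proof.
move=> GM Yfund; elim=> [_|j IH jk]; first by near=> t; rewrite subn0.
have {IH} := nbhs_interior (IH (ltnW jk)); rewrite /interior => IH.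
have Yfund' := nbhs_interior Yfund.
apply: filterS3 IH Yfund' GM => t IHt Yft GMt.
have [Yt Ydt] := nbhs_singleton Yft.
have Yu : \forall s \near t, Y s \in unitmx by apply: filterS Yft => s [].
rewrite derive1nS derive1E (near_eq_derive _ IHt) /= -(subnSK jk).
have D := is_derive_pullback (k - j.+1) (rodrigues G k p j) GMt Yu Ydt.
by rewrite (@derive_val _ _ _ _ _ _ _ D).
Unshelve. all: by end_near. Qed.

End RodriguesPolynomials.

(** * Homogeneity and the shift by a multiple of the identity *)

Section Homogeneity.
Context {K : numFieldType} {d : nat}.
Local Notation poly := (mpoly (2 + d) K).
Local Notation "'X_ i" := (mpolyX K (mnm1 i)) (at level 8, i at level 2).
Implicit Types (p : 'cV[poly]_d) (G : 'M[poly]_d) (x e : K) (w u : 'cV[K]_d).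

(** Homogeneity of degree n in w, as a property of the polynomial function. *)
Definition homogeneous n p := forall x e w c,
  evalmx p x e (c *: w) = c ^+ n *: evalmx p x e w.

(** Euler's identity, by differentiating p(c w) = c^n p(w) at c = 1. *)
Lemma euler n p x e w : homogeneous n p ->
  wdiff p x e w w = n%:R *: evalmx p x e w.
Proof.
move=> ph; have cd := is_derive_scale_mx (is_derive_id (1 : K) (1 : K)) (is_derive_cst w (1 : K) (1 : K)).
have := is_derive_evalmx p (is_derive_cst x (1 : K) (1 : K)) (is_derive_cst e (1 : K) (1 : K)) cd.
rewrite /cst scaler0 addr0 !scale1r !scale0r !add0r.
under eq_fun do rewrite ph.
move=> /(@derive_val _ _ _ _ _ _ _) <-.
have Xd : is_derive (1 : K) (1 : K) (fun t : K => t ^+ n) n%:R.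
  have := is_deriveX n (is_derive_id (1 : K) (1 : K)); rewrite exprfctE => H.
  by apply: is_derive_eq H _; rewrite expr1n /GRing.scale /= !mulr1.
have := is_derive_scale_mx Xd (is_derive_cst (evalmx p x e w) (1 : K) (1 : K)).
by move=> /(@derive_val _ _ _ _ _ _ _) ->; rewrite scaler0 addr0.
Qed.

Lemma homogeneous_partial_x n p : homogeneous n p -> homogeneous n (partial xindex p).
Proof.
move=> ph x e w c.
have /(@derive_val _ _ _ _ _ _ _) <- := is_derive_evalmx_x p x e (c *: w).
have H := is_derive_evalmx_x p x e w.
under eq_fun do rewrite ph.
have /(@derive_val _ _ _ _ _ _ _) := is_deriveZ (c ^+ n) H.
by rewrite -(@derive_val _ _ _ _ _ _ _ H).
Qed.

Lemma homogeneous_wdiff n p x e w u c : homogeneous n p ->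
  wdiff p x e (c *: w) (c *: u) = c ^+ n *: wdiff p x e w u.
Proof.
move=> ph.
have H := is_derive_evalmx p (is_derive_cst x w u) (is_derive_cst e w u) (is_derive_id w u).
have cd := is_deriveZ c (is_derive_id w u).
have H' := is_derive_evalmx p (is_derive_cst x w u) (is_derive_cst e w u) cd.
move: H H'; rewrite /cst !scale0r !add0r => /(is_deriveZ (c ^+ n)) H.
move=> /(@derive_val _ _ _ _ _ _ _) <-.
rewrite -(@derive_val _ _ _ _ _ _ _ H); congr ('D_u _ w).
by apply/funext => t; exact: ph.
Qed.

Lemma homogeneous_step n G c p :
  (forall x e w w', evalmx G x e w = evalmx G x e w') ->
  homogeneous n p -> homogeneous n (rodrigues_step G c p).
Proof.
move=> Gw ph x e w b; rewrite !evalmx_step ph (homogeneous_partial_x ph).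
rewrite (Gw x e (b *: w) w) -!scalemxAr (homogeneous_wdiff _ _ _ _ _ ph) !scalerBr !scalerDr.
by rewrite !scalerA ![b ^+ n * _]mulrC.
Qed.

Lemma homogeneous_rodrigues n G k p j :
  (forall x e w w', evalmx G x e w = evalmx G x e w') ->
  homogeneous n p -> homogeneous n (rodrigues G k p j).
Proof. by move=> Gw ph; elim: j => // j IH; exact: homogeneous_step. Qed.

(** The shift below is an equality of polynomial functions; as these determine
    the partial derivatives, it can be iterated. *)
Lemma evalmx_step_eq G c p p' :
  (forall x e w, evalmx p x e w = evalmx p' x e w) ->
  forall x e w, evalmx (rodrigues_step G c p) x e w =
                evalmx (rodrigues_step G c p') x e w.
Proof.
move=> pp.
have meval_p i v : meval v (p i 0) = meval v (p' i 0).
  pose w : 'cV[K]_d := \col_l v (windex l).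
  have vE : v =1 point (v xindex) (v eindex) w.
    move=> m; rewrite -[m]splitK; case: (fintype.split m) => [m0|l] /=; last first.
      by rewrite -/(windex l) pointw mxE.
    rewrite point_lshift; case: ifPn => [/eqP->//|m00]; congr v.
    apply/val_inj => /=; case: m0 m00 => -[|[|//]] //=.
  have /matrixP /(_ i 0) := pp (v xindex) (v eindex) w.
  by rewrite !mxE -!(meval_eq _ vE).
have partialE m x e w : evalmx (partial m p) x e w = evalmx (partial m p') x e w.
  apply/matrixP => i j; rewrite !mxE ord1.
  exact: mderiv_meval_eq (meval_p i) _.
move=> x e w; rewrite !evalmx_step pp partialE; congr (_ + _ - _).
by apply: eq_bigr => l _; rewrite partialE.
Qed.

(** The shift of the tilde system by a multiple of the identity multiplies
    Y^-1 q(Y w) by 1 / Q, by Euler's identity; this lowers by one the power of Q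
    in the recursion. *)
Lemma step_shift n G c p :
  (1 < n)%N -> homogeneous n p ->
  let G' := G - ((mpolyC _ (2 / (n%:R - 1))) * 'X_xindex)%:M in
  forall x e w,
    evalmx (rodrigues_step G' c.+1 p) x e w = evalmx (rodrigues_step G c p) x e w.
Proof.
move=> n1 ph G' x e w.
have G'E : evalmx G' x e w = evalmx G x e w - (2 / (n%:R - 1) * x)%:M.
  by rewrite /evalmx map_mxB map_scalar_mx /= mevalM mevalC mevalXU pointx.
have n10 : n%:R - 1 != 0 :> K by rewrite subr_eq0 pnatr_eq1 gtn_eqF.
clearbody G'.
apply: etrans (evalmx_step _ _ _ _ _ _) _.
apply: etrans _ (esym (evalmx_step _ _ _ _ _ _)).
rewrite G'E !mulmxBl !mul_scalar_mx wdiffD -scaleNr wdiffZ (euler _ _ _ ph).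
rewrite doubleS -addn2 natrD mulrDl scalerDl.
set h := evalmx p _ _ _; set hx := evalmx (partial _ _) _ _ _.
set W := wdiff _ _ _ _ _.
by apply/matrixP => i l; rewrite !mxE; field.
Qed.

Lemma rodrigues_shift n G k p j :
  (1 < n)%N -> (forall x e w w', evalmx G x e w = evalmx G x e w') ->
  homogeneous n p -> (j <= k.+1)%N ->
  let G' := G - ((mpolyC _ (2 / (n%:R - 1))) * 'X_xindex)%:M in
  forall x e w,
    evalmx (rodrigues G' k.+1 p j) x e w = evalmx (rodrigues G k p j) x e w.
Proof.
move=> n1 Gw ph jk G'; elim: j jk => [_ x e w|j IH jk]; first by rewrite !rodrigues0.
move=> x e w; rewrite (rodriguesS G') (rodriguesS G).
apply: etrans (evalmx_step_eq G' (k.+1 - j) (IH (ltnW jk)) x e w) _.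
rewrite (subSn (jk : (j <= k)%N)).
exact: step_shift n1 (homogeneous_rodrigues k j Gw ph) x e w.
Qed.

(** By homogeneity it suffices to bound p on the unit ball of w. *)
Lemma norm_evalmx_le n p (r : K) : homogeneous n p ->
  exists2 C : K, 0 <= C & forall x e w s, `|x| <= r -> `|e| <= r -> 0 <= s ->
    (forall l, `|w l 0| <= s) -> forall i, `|evalmx p x e w i 0| <= C * s ^+ n.
Proof.
move=> ph.
suff [C C0 HC] : exists2 C : K, 0 <= C & forall x e w, `|x| <= r -> `|e| <= r ->
    (forall l, `|w l 0| <= 1) -> forall i, `|evalmx p x e w i 0| <= C.
  exists C => // x e w s xr er s0 ws i.
  pose u : 'cV[K]_d := if s == 0 then 0 else s^-1 *: w.
  have wE : w = s *: u.
    rewrite /u; have [s00|s00] := eqVneq s 0; last by rewrite scalerA divff// scale1r.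
    apply/matrixP => l j; rewrite !mxE ord1 mulr0; apply/eqP.
    by rewrite -normr_le0 -s00 ws.
  rewrite wE ph mxE normrM normrX [`|s|]ger0_norm// mulrC ler_wpM2r ?exprn_ge0//.
  apply: HC => // l; rewrite /u; case: eqVneq => [_|s00]; first by rewrite mxE normr0 ler01.
  rewrite mxE normrM normfV [`|s|]ger0_norm// mulrC ler_pdivrMr ?mul1r//.
  by rewrite lt_def s00.
have /choice[C CP] : forall i, exists c : K, 0 <= c /\ forall v : 'I_(2 + d) -> K,
    (forall m, `|v m| <= 1 + `|r|) -> `|meval v (p i 0)| <= c.
  by move=> i; have [c c0 Hc] := bounded_meval (1 + `|r|) (p i 0); exists c.
exists (\sum_i C i) => [|x e w xr er w1 i]; first by apply: sumr_ge0 => i _; case: (CP i).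
rewrite mxE (bigD1 i)//= (le_trans ((CP i).2 _ _)) ?lerDl ?sumr_ge0//; last first.
  by move=> m _; case: (CP m).
have r0 : 0 <= r by exact: le_trans (normr_ge0 _) xr.
move=> m; rewrite -[m]splitK; case: (fintype.split m) => [m0|l] /=; last first.
  by rewrite -/(windex l) pointw (le_trans (w1 l))// lerDl.
by rewrite point_lshift [`|r|]ger0_norm//; case: ifP => _; rewrite (le_trans _ (_ : r <= _)) ?lerDr.
Qed.

End Homogeneity.

(** * The operators P_k *)

Section Lifting.
Context {K : numFieldType} {d : nat}.
Local Notation poly := (mpoly (2 + d) K).
Local Notation "'X_ i" := (mpolyX K (mnm1 i)) (at level 8, i at level 2).

Definition lift_vars (q : 'I_d -> mpoly d K) : 'cV[poly]_d :=
  \col_i comp_mpoly [tuple 'X_(windex j) | j < d] (q i).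

Lemma evalmx_lift_vars q x e w :
  evalmx (lift_vars q) x e w = \col_i meval (fun j => w j 0) (q i).
Proof.
apply/matrixP => i j; rewrite !mxE comp_mpoly_meval; apply: meval_eq => l.
by rewrite tnth_mktuple mevalXU pointw.
Qed.

Lemma homogeneous_lift_vars n (q : 'I_d -> dhomog d K n) :
  homogeneous n (lift_vars (fun i => mpoly_of_dhomog (q i))).
Proof.
move=> x e w c; rewrite !evalmx_lift_vars; apply/matrixP => i j; rewrite !mxE.
rewrite !mevalE mulr_sumr; apply: eq_big_seq => m mq.
have /dhomogP /(_ m mq) /= mn := valP (q i).
rewrite mulrCA; congr (_ * _); rewrite -{1}mn mdegE expr_sum -big_split.
by apply: eq_bigr => l _; rewrite mxE exprMn.
Qed.

(** Q M for the pair (A, B + e I), as a function of x and e. *)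
Definition coef_poly (A B : 'M[K]_d) : 'M[poly]_d :=
  'X_xindex *: (map_mx (@mpolyC (2 + d) K) (A + B) + ('X_eindex)%:M)
  + (map_mx (@mpolyC (2 + d) K) (A - B) - ('X_eindex)%:M).

Lemma evalmx_coef_poly A B x e w :
  evalmx (coef_poly A B) x e w = x *: (A + (B + e%:M)) + (A - (B + e%:M)).
Proof.
apply/matrixP => i j; rewrite !mxE.
rewrite !(mevalD, mevalM, mevalN, mevalC, mevalMn, mevalXU) pointx pointe.
by move: (e *+ _) => b; ring.
Qed.

(** The same for the tilde system attached to degree n. *)
Definition coef_poly_tilde (n : nat) (A B : 'M[K]_d) : 'M[poly]_d :=
  coef_poly A B - ((mpolyC _ (2 / (n%:R - 1))) * 'X_xindex)%:M.

Lemma evalmx_coef_poly_tilde n A B x e w :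
  evalmx (coef_poly_tilde n A B) x e w =
  evalmx (coef_poly A B) x e w - (2 / (n%:R - 1) * x)%:M.
Proof. by rewrite /evalmx map_mxB map_scalar_mx /= mevalM mevalC mevalXU pointx. Qed.

End Lifting.

Section Operators.
Context {R : realType} {d : nat}.
Local Notation C := R[i].
Implicit Types (A B : 'M[C]_d) (x e : C) (w : 'cV[C]_d).

(** For v = Y(x)^-1 w, the function differentiated in P_k is the pullback of q
    along Y(t) v; the outer factor Y(x) cancels the Y(x)^-1 of the pullback. *)
Lemma Pop_rodrigues n (q : @Pspace R d n) k (M Y : C -> 'M[C]_d) G x e w :
  (forall w, \forall z \near x, Qpol z *: M z = evalmx G z e (Y z *m w)) ->
  fundamental_near M x Y ->
  Pop Y k x (Peval q) w =
  evalmx (rodrigues G k (lift_vars (fun i => mpoly_of_dhomog (q i))) k) x e w.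
Proof.
move=> GM Yf; have [Yx _] := nbhs_singleton Yf.
pose v := invmx (Y x) *m w.
have := derive1n_rodrigues (k := k) (lift_vars (fun i => mpoly_of_dhomog (q i))) (GM v) Yf (leqnn k).
move=> /nbhs_singleton; rewrite subnn expr0 scale1r /v mulmxA mulmxV// mul1mx => E.
apply: etrans (congr1 (mulmx (Y x)) (etrans _ E)) _; last first.
  by rewrite mulmxA mulmxV// mul1mx.
apply: (congr1 (fun f => derive1n k f x)).
apply/funext => t.
rewrite evalmx_lift_vars.
rewrite -mulmxA.
reflexivity.
Qed.

End Operators.

(** * The differential relation *)

Section DifferentialForm.
Context {R : realType} {d : nat}.
Local Notation C := R[i].
Implicit Types (A B : 'M[C]_d) (x e : C) (w : 'cV[C]_d).

Local Notation lifted q := (lift_vars (fun i => mpoly_of_dhomog (q i))).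

Lemma near_neq x a : x != a -> \forall z \near x, z != a.
Proof.
move=> xa; apply/nbhs_ballP; exists `|x - a| => /=.
  by rewrite normr_gt0 subr_eq0.
by move=> z; apply: contraTneq => ->; rewrite /ball /= ltxx.
Qed.

Lemma Qpol_neq0 x : x != 1 -> x != -1 -> Qpol x != 0.
Proof.
move=> x1 xN1; rewrite /Qpol (_ : _ - 1 = (x - 1) * (x + 1)); last by ring.
by rewrite mulf_neq0// ?subr_eq0// -(opprK 1) subr_eq0.
Qed.

Lemma Qpol_Msys A B x e w : x != 1 -> x != -1 ->
  Qpol x *: Msys A (B + e%:M) x = evalmx (coef_poly A B) x e w.
Proof.
move=> x1 xN1; rewrite evalmx_coef_poly /Msys /Qpol.
have x10 : x - 1 != 0 by rewrite subr_eq0.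
have x20 : x + 1 != 0 by rewrite -(opprK 1) subr_eq0.
move: (B + e%:M) => B'.
by apply/matrixP => i j; rewrite !mxE; field; rewrite x10 x20.
Qed.

Lemma Qpol_Mtilde n A B x e w : (1 < n)%N -> x != 1 -> x != -1 ->
  Qpol x *: Mtilde A (B + e%:M) n x = evalmx (coef_poly_tilde n A B) x e w.
Proof.
move=> n1 x1 xN1; rewrite evalmx_coef_poly_tilde -Qpol_Msys//.
rewrite /Mtilde scalerBr scale_scalar_mx; congr (_ - _%:M).
have n10 : n%:R - 1 != 0 :> C by rewrite subr_eq0 pnatr_eq1 gtn_eqF.
by field; rewrite n10 Qpol_neq0.
Qed.

Lemma Pop_Msys n (q : @Pspace R d n) k A B x e Y w : x != 1 -> x != -1 ->
  fundamental_near (Msys A (B + e%:M)) x Y ->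
  Pop Y k x (Peval q) w = evalmx (rodrigues (coef_poly A B) k (lifted q) k) x e w.
Proof.
move=> x1 xN1; apply: Pop_rodrigues => v.
by apply: filterS2 (near_neq x1) (near_neq xN1) => z z1 zN1; exact: Qpol_Msys.
Qed.

Lemma coef_poly_indep A B x e w w' :
  evalmx (coef_poly A B) x e w = evalmx (coef_poly A B) x e w'.
Proof. by rewrite !evalmx_coef_poly. Qed.

(** The k + 1 steps of the tilde system have constants k + 1, ..., 1; the shift
    turns them into k, ..., 0. *)
Lemma Pop_Mtilde n (q : @Pspace R d n) k A B x e Y w : (1 < n)%N ->
  x != 1 -> x != -1 -> fundamental_near (Mtilde A (B + e%:M) n) x Y ->
  Pop Y k.+1 x (Peval q) w =
  evalmx (rodrigues_step (coef_poly A B) 0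
            (rodrigues (coef_poly A B) k (lifted q) k)) x e w.
Proof.
move=> n1 x1 xN1 Yf.
transitivity (evalmx (rodrigues (coef_poly_tilde n A B) k.+1 (lifted q) k.+1) x e w).
  apply: Pop_rodrigues Yf => v.
  by apply: filterS2 (near_neq x1) (near_neq xN1) => z z1 zN1; exact: Qpol_Mtilde.
apply: etrans (rodrigues_shift n1 (coef_poly_indep A B)
  (homogeneous_lift_vars q) (leqnn _) x e w) _.
by rewrite rodriguesS subnn.
Qed.

Lemma Dop_evalmx (M0 : 'M[C]_d) p x e w :
  Dop M0 (evalmx p x e) w = wdiff p x e w (M0 *m w) - M0 *m evalmx p x e w.
Proof. by rewrite /Dop diff_evalmx. Qed.

(** With constant 0 the step of the recursion is x D_1 + D_2 + Q d/dx. *)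
Theorem differential_relation n (q : @Pspace R d n) k A B x w (Y Yt : C -> 'M[C]_d) :
  (1 < n)%N -> x != 1 -> x != -1 ->
  fundamental_near (Msys A B) x Y -> fundamental_near (Mtilde A B n) x Yt ->
  [/\ derivable (fun t : C => Pop Y k t (Peval q) w) x 1,
      differentiable (Pop Y k x (Peval q)) w,
      derive1 (fun t : C => Pop Y k t (Peval q) w) x
      + 'd (Pop Y k x (Peval q)) w (Msys A B x *m w)
      - Msys A B x *m Pop Y k x (Peval q) w
      = (Qpol x)^-1 *: Pop Yt k.+1 x (Peval q) w
    & x *: Dop (A + B) (Pop Y k x (Peval q)) w
      + Dop (A - B) (Pop Y k x (Peval q)) w
      + Qpol x *: derive1 (fun t : C => Pop Y k t (Peval q) w) x
      = Pop Yt k.+1 x (Peval q) w].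
Proof.
move=> n1 x1 xN1 Yf Ytf; pose r := rodrigues (coef_poly A B) k (lifted q) k.
have B0 : B = B + 0%:M by rewrite -scalemx1 scale0r addr0.
have PE : \forall t \near x, Pop Y k t (Peval q) w = evalmx r t 0 w.
  apply: filterS3 (near_neq x1) (near_neq xN1) (nbhs_interior Yf) => t t1 tN1 Ytf'.
  by apply: Pop_Msys => //; rewrite -B0.
have PwE : Pop Y k x (Peval q) = evalmx r x 0.
  by apply/funext => u; apply: Pop_Msys => //; rewrite -B0.
have Pd : is_derive x 1 (fun t : C => Pop Y k t (Peval q) w)
    (evalmx (partial xindex r) x 0 w).
  apply: near_eq_is_derive (is_derive_evalmx_x r x 0 w).
  by apply: filterS PE => t ->.
have opE : x *: Dop (A + B) (Pop Y k x (Peval q)) w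
      + Dop (A - B) (Pop Y k x (Peval q)) w
      + Qpol x *: derive1 (fun t : C => Pop Y k t (Peval q) w) x
      = Pop Yt k.+1 x (Peval q) w.
  rewrite derive1E (@derive_val _ _ _ _ _ _ _ Pd) PwE !Dop_evalmx.
  rewrite (@Pop_Mtilde n q k A B x 0 Yt w)// -?B0// evalmx_step -/r evalmx_coef_poly -B0.
  rewrite mul0r scale0r add0r; move: (A + B) (A - B) => S D.
  rewrite !mulmxDl -!scalemxAl !wdiffD !wdiffZ /Qpol.
  move: (S *m evalmx _ _ _ _) (D *m evalmx _ _ _ _) (evalmx (partial _ _) _ _ _)
    (wdiff _ _ _ _ (S *m w)) (wdiff _ _ _ _ (D *m w)) => b b' c a a'.
  by apply/matrixP => i j; rewrite !mxE; ring.
have MsysE : Msys A B x = (Qpol x)^-1 *: (x *: (A + B) + (A - B)).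
  rewrite [in LHS]B0 -[LHS]scale1r -(mulVf (Qpol_neq0 x1 xN1)) -scalerA.
  by rewrite (Qpol_Msys A B 0 0 x1 xN1) evalmx_coef_poly -B0.
split=> //.
- by rewrite PwE; exact: differentiable_evalmx.
- rewrite -opE derive1E (@derive_val _ _ _ _ _ _ _ Pd) PwE diff_evalmx !Dop_evalmx.
  rewrite MsysE; have := Qpol_neq0 x1 xN1.
  move: (A + B) (A - B) (Qpol x) => S D Q Q0.
  rewrite -!scalemxAl !mulmxDl -!scalemxAl wdiffZ wdiffD wdiffZ.
  move: (S *m evalmx _ _ _ _) (D *m evalmx _ _ _ _) (evalmx (partial _ _) _ _ _)
    (wdiff _ _ _ _ (S *m w)) (wdiff _ _ _ _ (D *m w)) => b b' c a a'.
  rewrite -[c in LHS]scale1r -(mulVf Q0).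
  by apply/matrixP => i j; rewrite !mxE; ring.
Qed.

End DifferentialForm.

(** * Complex-valued functions of a real variable *)

Section ComplexValuedFunctions.
Context {R : realType}.
Local Notation C := R[i].
Local Notation Re := complex.Re.
Local Notation Im := complex.Im.
Implicit Types (z l : C) (s : R).

Lemma ReD z l : Re (z + l) = Re z + Re l. Proof. by case: z l => a b []. Qed.
Lemma ImD z l : Im (z + l) = Im z + Im l. Proof. by case: z l => a b []. Qed.
Lemma ReB z l : Re (z - l) = Re z - Re l. Proof. by case: z l => a b []. Qed.
Lemma ImB z l : Im (z - l) = Im z - Im l. Proof. by case: z l => a b []. Qed.
Lemma ReM z l : Re (z * l) = Re z * Re l - Im z * Im l.
Proof. by case: z l => a b []. Qed.
Lemma ImM z l : Im (z * l) = Re z * Im l + Im z * Re l.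
Proof. by case: z l => a b []. Qed.

Lemma real_complexV (r : R) : (r^-1)%:C = (r%:C)^-1.
Proof. exact: fmorphV. Qed.

Lemma Re_real_complexM (r : R) z : Re (r%:C * z) = r * Re z.
Proof. by rewrite ReM /= mul0r subr0. Qed.

Lemma Im_real_complexM (r : R) z : Im (r%:C * z) = r * Im z.
Proof. by rewrite ImM /= mul0r addr0. Qed.

Lemma Re_sum (I : Type) (r : seq I) (F : I -> C) :
  Re (\sum_(i <- r) F i) = \sum_(i <- r) Re (F i).
Proof. by elim: r => [|i r IH]; rewrite ?big_nil// !big_cons ReD IH. Qed.

Lemma Im_sum (I : Type) (r : seq I) (F : I -> C) :
  Im (\sum_(i <- r) F i) = \sum_(i <- r) Im (F i).
Proof. by elim: r => [|i r IH]; rewrite ?big_nil// !big_cons ImD IH. Qed.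

(** The modulus as a real number. *)
Definition cmod z : R := Re `|z|.

Lemma cmodE z : `|z| = (cmod z)%:C.
Proof. by rewrite /cmod normc_def. Qed.

Lemma cmod_ge0 z : 0 <= cmod z.
Proof. by rewrite -lecR -cmodE; exact: normr_ge0. Qed.

Lemma cmod_le z (r : R) : (cmod z <= r) = (`|z| <= r%:C).
Proof. by rewrite cmodE lecR. Qed.

Lemma normr_Re_le z : `|Re z| <= cmod z.
Proof.
rewrite /cmod normc_def /= -sqrtr_sqr ler_sqrt ?addr_ge0 ?sqr_ge0//.
by rewrite lerDl sqr_ge0.
Qed.

Lemma normr_Im_le z : `|Im z| <= cmod z.
Proof.
rewrite /cmod normc_def /= -sqrtr_sqr ler_sqrt ?addr_ge0 ?sqr_ge0//.
by rewrite lerDr sqr_ge0.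
Qed.

Lemma cmod_le_add z : cmod z <= `|Re z| + `|Im z|.
Proof.
rewrite /cmod normc_def /= -[leRHS]ger0_norm ?addr_ge0// -sqrtr_sqr.
rewrite ler_sqrt ?sqr_ge0// -real_normK ?num_real// -[X in _ + X]real_normK ?num_real//.
by rewrite sqrrD addrAC lerDl mulrn_wge0// mulr_ge0.
Qed.

Lemma cvg_complexP (T : Type) (F : set_system T) {FF : Filter F} (f : T -> C) l :
  f @ F --> l <-> Re (f x) @[x --> F] --> Re l /\ Im (f x) @[x --> F] --> Im l.
Proof.
split=> [fl|[fR fI]].
  split; apply/cvgrPdist_le => e e0;
    have e0' : 0 < e%:C by rewrite ltcR.
  - have /cvgrPdist_le /(_ _ e0') := fl; apply: filterS => x; rewrite -cmod_le.
    by apply: le_trans; rewrite -ReB normr_Re_le.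
  - have /cvgrPdist_le /(_ _ e0') := fl; apply: filterS => x; rewrite -cmod_le.
    by apply: le_trans; rewrite -ImB normr_Im_le.
apply/cvgrPdist_le => e; rewrite ltcE => /andP[/eqP /= e0 eR].
have eE : e = (Re e)%:C by case: e e0 eR => a b /= ->.
have e2 : 0 < Re e / 2 by rewrite divr_gt0.
have /cvgrPdist_le /(_ _ e2) H1 := fR.
have /cvgrPdist_le /(_ _ e2) H2 := fI.
apply: filterS2 H1 H2 => x; rewrite -ReB -ImB => h1 h2.
rewrite eE -cmod_le (le_trans (cmod_le_add _))// [leRHS](splitr (Re e)).
exact: lerD.
Qed.

(** R[i] is a normed space over itself only, hence the explicit difference
    quotient. *)
Definition has_cderiv (h : R -> C) s l :=
  ((u%:C)^-1 * (h (u + s) - h s) : C) @[u --> 0^'] --> l.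

Lemma has_cderivP h s l : has_cderiv h s l <->
  is_derive s 1 (fun t => Re (h t)) (Re l) /\ is_derive s 1 (fun t => Im (h t)) (Im l).
Proof.
have qR u : Re ((u%:C)^-1 * (h (u + s) - h s)) =
    u^-1 *: (Re (h (u *: 1 + s)) - Re (h s)).
  by rewrite -real_complexV Re_real_complexM ReB /GRing.scale /= mulr1.
have qI u : Im ((u%:C)^-1 * (h (u + s) - h s)) =
    u^-1 *: (Im (h (u *: 1 + s)) - Im (h s)).
  by rewrite -real_complexV Im_real_complexM ImB /GRing.scale /= mulr1.
split=> [/cvg_complexP[hR hI]|[/is_deriveP hR /is_deriveP hI]].
  split; apply/is_deriveP.
    by move: hR; rewrite (_ : (fun u => _) = fun u => u^-1 *: (Re (h (u *: 1 + s)) - Re (h s)))//; apply/funext.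
  by move: hI; rewrite (_ : (fun u => _) = fun u => u^-1 *: (Im (h (u *: 1 + s)) - Im (h s)))//; apply/funext.
apply/cvg_complexP; split.
  by rewrite (_ : (fun u => _) = fun u => u^-1 *: (Re (h (u *: 1 + s)) - Re (h s)))//; apply/funext.
by rewrite (_ : (fun u => _) = fun u => u^-1 *: (Im (h (u *: 1 + s)) - Im (h s)))//; apply/funext.
Qed.

Lemma near_eq_has_cderiv h k s l : (\forall t \near s, h t = k t) ->
  has_cderiv h s l -> has_cderiv k s l.
Proof.
move=> hk /has_cderivP[hR hI]; apply/has_cderivP; split.
  by apply: near_eq_is_derive hR; apply: filterS hk => t ->.
by apply: near_eq_is_derive hI; apply: filterS hk => t ->.
Qed.

Lemma has_cderiv_continuous h s l : has_cderiv h s l -> {for s, continuous h}.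
Proof.
move=> /has_cderivP[[hR _] [hI _]]; apply/cvg_complexP; split.
  have /derivable1_diffP := hR; exact: differentiable_continuous.
have /derivable1_diffP := hI; exact: differentiable_continuous.
Qed.

(** The difference quotient of f along the path, extended continuously where the
    path returns to g s, times that of the path. *)
Lemma has_cderiv_comp (f : C -> C) (g : R -> C) s l m :
  is_derive (g s) 1 f l -> has_cderiv g s m -> has_cderiv (f \o g) s (l * m).
Proof.
move=> /is_deriveP fl gm; have gc := has_cderiv_continuous gm.
pose phi (h : C) : C := if h == 0 then l else h^-1 * (f (h + g s) - f (g s)).
have phil : phi @ 0 --> l.
  have phi0 : phi 0 = l by rewrite /phi eqxx.
  rewrite -[in X in _ --> X]phi0; apply/continuous_withinNx; rewrite phi0.
  apply: cvg_trans fl; apply: near_eq_cvg; near=> h.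
  rewrite /phi ifF /GRing.scale /= ?mulr1//; apply/negbTE.
  by near: h; exact: nbhs_dnbhs_neq.
rewrite /has_cderiv (_ : (fun u => _) =
  fun u => phi (g (u + s) - g s) * ((u%:C)^-1 * (g (u + s) - g s))); last first.
  apply/funext => u /=; rewrite mulrCA; congr (_ * _); rewrite /phi.
  case: eqVneq => [/eqP|h0]; first by rewrite subr_eq0 => /eqP ->; rewrite !subrr mulr0.
  by rewrite subrK mulrAC mulVf// mul1r.
apply: cvgM; last exact: gm.
apply: (@cvg_comp _ _ _ (fun u : R => g (u + s) - g s) phi _ _ _ _ phil).
have us : (u + s : R) @[u --> (0 : R)^'] --> s.
  apply: cvg_within_filter.
  have : (u + s : R) @[u --> (0 : R)] --> 0 + s.
    by apply: cvgD; [exact: cvg_id|exact: cvg_cst].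
  by rewrite add0r.
have : (g (u + s) - g s) @[u --> (0 : R)^'] --> g s - g s.
  apply: cvgB; last exact: cvg_cst.
  exact: (@cvg_comp _ _ _ (fun u : R => u + s) g _ _ _ us gc).
by rewrite subrr.
Unshelve. all: by end_near. Qed.

End ComplexValuedFunctions.

(** * Growth of solutions at a regular singular point *)

Section Growth.
Context {R : realType} {d : nat}.
Local Notation C := R[i].
Local Notation Re := complex.Re.
Local Notation Im := complex.Im.

Lemma cmodM (z l : C) : cmod (z * l) = cmod z * cmod l.
Proof. by apply: complexI; rewrite -cmodE normrM !cmodE rmorphM. Qed.

Lemma cmod_real_complex (r : R) : cmod r%:C = `|r|.
Proof. by rewrite /cmod normc_def /= expr0n addr0 sqrtr_sqr. Qed.

Lemma cmodD (z l : C) : cmod (z + l) <= cmod z + cmod l.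
Proof. by rewrite cmod_le rmorphD /= -!cmodE ler_normD. Qed.

Lemma cmod_sum (I : Type) (r : seq I) (F : I -> C) :
  cmod (\sum_(i <- r) F i) <= \sum_(i <- r) cmod (F i).
Proof.
elim: r => [|i r IH]; first by rewrite !big_nil /cmod normr0.
by rewrite !big_cons (le_trans (cmodD _ _))// lerD2l.
Qed.

Lemma sqr_cmod (z : C) : cmod z ^+ 2 = Re z ^+ 2 + Im z ^+ 2.
Proof. by rewrite /cmod normc_def /= sqr_sqrtr// addr_ge0// sqr_ge0. Qed.

(** Schur triangularization, followed by a conjugation by diag(1, t, t^2, ..)
    with t small. *)
Lemma almost_diagonal (B : 'M[C]_d) (eta : R) : (0 < d)%N -> 0 < eta ->
  exists S : 'M[C]_d, [/\ S \in unitmx,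
    forall i, eigenvalue B ((S *m B *m invmx S) i i) &
    forall i j, i != j -> cmod ((S *m B *m invmx S) i j) <= eta].
Proof.
move=> d0 eta0; have [P /unitarymx_unit Pu] := Schur B d0.
rewrite /similar_to /= conjumx// => /is_trig_mxP; set L := P *m B *m invmx P => Ltrig.
pose b := \sum_i \sum_j cmod (L i j).
have b0 : 0 <= b by apply: sumr_ge0 => i _; apply: sumr_ge0 => j _; exact: cmod_ge0.
have Lb i j : cmod (L i j) <= b.
  rewrite /b (bigD1 i)//= (bigD1 j)//= -addrA lerDl addr_ge0 ?sumr_ge0// => k _.
    exact: cmod_ge0.
  by apply: sumr_ge0 => ? _; exact: cmod_ge0.
(* The entry (i, j) with j < i is multiplied by t^(i - j) <= t. *)
pose t := eta / (eta + b).
have eb0 : 0 < eta + b by rewrite ltr_wpDr.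
have t0 : 0 < t by rewrite divr_gt0.
have t1 : t <= 1 by rewrite ler_pdivrMr// mul1r lerDl.
have tb : t * b <= eta.
  by rewrite mulrAC ler_pdivrMr// ler_wpM2l ?(ltW eta0)// lerDr ltW.
pose D := diag_mx (\row_(i < d) (t ^+ i)%:C : 'rV[C]_d).
pose D' := diag_mx (\row_(i < d) (t ^- i)%:C : 'rV[C]_d).
have DD' : D *m D' = 1%:M.
  rewrite /D /D' mulmx_diag; apply/matrixP => i j; rewrite !mxE.
  by case: eqP => // ->; rewrite -rmorphM /= divff// expf_neq0// gt_eqF.
have [Du D'E] : D \in unitmx /\ invmx D = D'.
  have [Du _] := mulmx1_unit DD'; split; first exact: Du.
  by rewrite -[RHS]mul1mx -(mulVmx Du) -mulmxA DD' mulmx1.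
have SE : (D *m P) *m B *m invmx (D *m P) = D *m L *m D'.
  have DPu : D *m P \in unitmx by rewrite unitmx_mul Du.
  rewrite -[RHS](mulmxK DPu); congr (_ *m _).
  by rewrite -D'E mulmxA mulmxKV// /L !mulmxA mulmxKV.
have entry (M : 'M[C]_d) i j : (D *m M *m D') i j = (t ^+ i)%:C * M i j * (t ^- j)%:C.
  by rewrite mul_mx_diag mul_diag_mx !mxE.
exists (D *m P); split; first by rewrite unitmx_mul Du.
- move=> i; rewrite SE entry.
  rewrite mulrAC -rmorphM /= divff ?expf_neq0 ?gt_eqF// mul1r.
  have : eigenvalue L (L i i).
    rewrite eigenvalue_root_char char_poly_trig; last by apply/is_trig_mxP.
    by rewrite /root horner_prod (bigD1 i)//= !hornerE subrr mul0r.
  move=> /eigenvalueP[v vL v0]; apply/eigenvalueP; exists (v *m P).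
    have := congr1 (mulmx^~ P) vL; rewrite -scalemxAl => <-.
    by rewrite /L !mulmxA mulmxKV.
  apply: contraNneq v0 => vP; apply/eqP.
  by rewrite -[v]mulmx1 -(mulmxV Pu) mulmxA vP mul0mx.
- move=> i j ij; rewrite SE entry.
  have [lt_ij|le_ji] := ltnP i j.
    by rewrite Ltrig// mulr0 mul0r -[0]/(0%:C) cmod_real_complex normr0 ltW.
  have lt_ji : (j < i)%N by rewrite ltn_neqAle eq_sym ij.
  rewrite mulrAC -rmorphM /= cmodM cmod_real_complex ger0_norm; last first.
    by rewrite mulr_ge0// ?invr_ge0// exprn_ge0// ltW.
  rewrite -expfB// (le_trans _ tb)// ler_pM ?cmod_ge0 ?exprn_ge0 ?(ltW t0)//.
  by rewrite -[leRHS]expr1 ler_wiXn2l ?subn_gt0 ?(ltW t0).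
Qed.

(** If s y' = K y where the diagonal entries of K have real part at least
    alpha + 2 d kappa and the others are at most kappa, then
    E = sum |y_i|^2 satisfies s E' >= 2 alpha E, so E s^(-2 alpha) is
    nondecreasing. *)
Lemma energy_growth (y : R -> 'cV[C]_d) (K : R -> 'M[C]_d) (alpha kappa delta : R) :
  0 < delta -> 0 <= kappa ->
  (forall s, 0 < s <= delta -> forall i,
     has_cderiv (fun t => y t i 0) s ((s^-1)%:C * (K s *m y s) i 0)) ->
  (forall s, 0 < s <= delta -> forall i, alpha + 2 * d%:R * kappa <= Re (K s i i)) ->
  (forall s, 0 < s <= delta -> forall i j, i != j -> cmod (K s i j) <= kappa) ->
  exists2 c : R, 0 <= c & forall s, 0 < s <= delta -> forall i,
    cmod (y s i 0) <= c * s `^ alpha.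
Proof.
move=> delta0 kappa0 yd Kdiag Koff.
pose e i t := Re (y t i 0) ^+ 2 + Im (y t i 0) ^+ 2.
pose E t := \sum_i e i t.
pose e' i (s : R) := 2 * s^-1 * (Re (y s i 0) * Re ((K s *m y s) i 0)
                           + Im (y s i 0) * Im ((K s *m y s) i 0)).
have e_ge0 i t : 0 <= e i t by rewrite addr_ge0 ?sqr_ge0.
have Ed s : 0 < s <= delta -> is_derive s 1 E (\sum_i e' i s).
  move=> s0d; apply: is_derive_sumf => i.
  have /has_cderivP[yR yI] := yd s s0d i.
  have H := is_deriveD (is_deriveM yR yR) (is_deriveM yI yI).
  apply: is_derive_eq H _.
  rewrite /e' Re_real_complexM Im_real_complexM /GRing.scale /=; ring.
have E'ge s : 0 < s <= delta -> 2 * alpha / s * E s <= \sum_i e' i s.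
  move=> s0d; have s0 : 0 < s by case/andP: s0d.
  rewrite /e' -mulr_sumr (_ : 2 * alpha / s * E s = 2 * s^-1 * (alpha * E s)); last by ring.
  rewrite ler_pM2l ?mulr_gt0 ?invr_gt0//.
  have term i j : i != j -> - (kappa * (e i s + e j s)) <=
      Re (y s i 0) * Re (K s i j * y s j 0) + Im (y s i 0) * Im (K s i j * y s j 0).
    move=> ij; rewrite /e; have := Koff s s0d i j ij.
    move: (K s i j) (y s i 0) (y s j 0) => k u v kk.
    have kR := le_trans (normr_Re_le _) kk; have kI := le_trans (normr_Im_le _) kk.
    case: k {kk} kR kI => p q /=; case: u => a b; case: v => a' b' /= /ler_normlP[p1 p2] /ler_normlP[q1 q2].
    have : 0 <= a ^+ 2 + b ^+ 2 + (a' ^+ 2 + b' ^+ 2) + 2 * (a * a' + b * b').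
      by have := sqr_ge0 (a + a'); have := sqr_ge0 (b + b'); nra.
    have : 0 <= a ^+ 2 + b ^+ 2 + (a' ^+ 2 + b' ^+ 2) - 2 * (a * a' + b * b').
      by have := sqr_ge0 (a - a'); have := sqr_ge0 (b - b'); nra.
    have : 0 <= a ^+ 2 + b ^+ 2 + (a' ^+ 2 + b' ^+ 2) + 2 * (b * a' - a * b').
      by have := sqr_ge0 (b + a'); have := sqr_ge0 (a - b'); nra.
    have : 0 <= a ^+ 2 + b ^+ 2 + (a' ^+ 2 + b' ^+ 2) - 2 * (b * a' - a * b').
      by have := sqr_ge0 (b - a'); have := sqr_ge0 (a + b'); nra.
    set A := _ ^+ 2 + _ + _; set X := a * a' + _; set Y := b * a' - _ => h1 h2 h3 h4.
    have -> : a * (p * a' - q * b') + b * (p * b' + q * a') = p * X + q * Y.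
      by rewrite /X /Y; ring.
    have [pm pp] : 0 <= kappa + p /\ 0 <= kappa - p by split; lra.
    have [qm qp] : 0 <= kappa + q /\ 0 <= kappa - q by split; lra.
    have := mulr_ge0 pm h4; have := mulr_ge0 pp h3.
    by have := mulr_ge0 qm h2; have := mulr_ge0 qp h1; lra.
  pose T i j := Re (y s i 0) * Re (K s i j * y s j 0) + Im (y s i 0) * Im (K s i j * y s j 0).
  have TE i : Re (y s i 0) * Re ((K s *m y s) i 0) + Im (y s i 0) * Im ((K s *m y s) i 0)
      = \sum_j T i j.
    by rewrite mxE Re_sum Im_sum !mulr_sumr -big_split.
  under eq_bigr do rewrite TE.
  have Tge i j : (i == j)%:R * ((alpha + 2 * d%:R * kappa) * e i s) - kappa * (e i s + e j s) <= T i j.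
    have [<-|ij] := eqVneq i j; last by rewrite mul0r sub0r term.
    rewrite mul1r lerBlDr (@le_trans _ _ (T i i))//; last first.
      by rewrite lerDl mulr_ge0// addr_ge0.
    have -> : T i i = Re (K s i i) * e i s by rewrite /T /e ReM ImM; ring.
    by rewrite ler_wpM2r// Kdiag.
  have : \sum_i \sum_j ((i == j)%:R * ((alpha + 2 * d%:R * kappa) * e i s) - kappa * (e i s + e j s))
      <= \sum_i \sum_j T i j by apply: ler_sum => i _; apply: ler_sum.
  apply: le_trans; rewrite le_eqVlt; apply/orP; left; apply/eqP.
  pose c := alpha + 2 * d%:R * kappa.
  have inner i : \sum_j ((i == j)%:R * (c * e i s) - kappa * (e i s + e j s)) =
      c * e i s - kappa * (d%:R * e i s + E s).
    rewrite sumrB; congr (_ - _).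
      rewrite (bigD1 i)//= eqxx mul1r big1 ?addr0// => j /negbTE.
      by rewrite eq_sym => ->; rewrite mul0r.
    by rewrite -mulr_sumr big_split /= sumr_const card_ord -[e i s *+ d]mulr_natl.
  have outer : \sum_(i < d) (d%:R * e i s + E s) = d%:R * E s + d%:R * E s.
    by rewrite big_split /= -mulr_sumr sumr_const card_ord -[E s *+ d]mulr_natl.
  rewrite (eq_bigr _ (fun i _ => inner i)) sumrB -!mulr_sumr outer -/(E s) /c.
  by ring.
pose phi t := E t * t `^ (- (2 * alpha)).
have phid s : 0 < s <= delta -> is_derive s 1 phi
    ((\sum_i e' i s - 2 * alpha / s * E s) * s `^ (- (2 * alpha))).
  move=> s0d; have s0 : 0 < s by case/andP: s0d.
  have /= := is_deriveM (Ed s s0d) (is_derive1_powR (- (2 * alpha)) s0).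
  move=> H; apply: is_derive_eq H _; rewrite /GRing.scale /=.
  rewrite powRB ?powRr1 ?(ltW s0)//; last by rewrite (gt_eqF s0) implybT.
  by ring.
have phi_le s : 0 < s <= delta -> phi s <= phi delta.
  move=> /andP[s0 sd]; apply: (@ger0_derive1_ndecr _ phi s delta) => //.
  - move=> t; rewrite in_itv/= => /andP[st td].
    by apply: (@ex_derive _ _ _ _ _ _ _ (phid t _)); rewrite (lt_trans s0 st) ltW.
  - move=> t; rewrite in_itv/= => /andP[st td]; have t0 := lt_trans s0 st.
    have t0d : 0 < t <= delta by rewrite t0 ltW.
    rewrite derive1E (@derive_val _ _ _ _ _ _ _ (phid t t0d)).
    by rewrite mulr_ge0 ?powR_ge0// subr_ge0 E'ge.
  - apply: derivable_within_continuous => t; rewrite in_itv/= => /andP[st td].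
    by apply: (@ex_derive _ _ _ _ _ _ _ (phid t _)); rewrite (lt_le_trans s0 st).
exists (Num.sqrt (phi delta)) => [|s s0d i]; first exact: sqrtr_ge0.
have s0 : 0 < s by case/andP: s0d.
have phi0 : 0 <= phi delta by rewrite mulr_ge0 ?powR_ge0 ?sumr_ge0.
rewrite -(ler_pXn2r (n := 2))// ?nnegrE ?cmod_ge0 ?mulr_ge0 ?sqrtr_ge0 ?powR_ge0//.
rewrite sqr_cmod exprMn sqr_sqrtr//.
have -> : (s `^ alpha) ^+ 2 = (s `^ (- (2 * alpha)))^-1.
  by rewrite powRN invrK mulrC powRrM powR_mulrn// powR_ge0.
rewrite -ler_pdivrMr ?invrK ?invr_gt0 ?powR_gt0//.
apply: le_trans (phi_le s s0d); rewrite ler_wpM2r ?powR_ge0//.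
by rewrite /E (bigD1 i)//= lerDl sumr_ge0.
Qed.

End Growth.

Section SystemGrowth.
Context {R : realType}.
Local Notation C := R[i].
Local Notation Re := complex.Re.

Lemma has_cderivD (h k : R -> C) s l m : has_cderiv h s l -> has_cderiv k s m ->
  has_cderiv (fun t => h t + k t) s (l + m).
Proof.
move=> hl km; rewrite /has_cderiv.
rewrite (_ : (fun u => _) = fun u => (u%:C)^-1 * (h (u + s) - h s)
                                   + (u%:C)^-1 * (k (u + s) - k s)).
  by apply: cvgD; [exact: hl|exact: km].
by apply/funext => u; ring.
Qed.

Lemma has_cderivZ (h : R -> C) s l (c : C) : has_cderiv h s l ->
  has_cderiv (fun t => c * h t) s (c * l).
Proof.
move=> hl; rewrite /has_cderiv.
rewrite (_ : (fun u => _) = fun u => c * ((u%:C)^-1 * (h (u + s) - h s))).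
  by apply: cvgM; [exact: cvg_cst|exact: hl].
by apply/funext => u; ring.
Qed.

Lemma has_cderiv_cst s (c : C) : has_cderiv (fun=> c) s 0.
Proof.
rewrite /has_cderiv (_ : (fun u => _) = fun=> 0); first exact: cvg_cst.
by apply/funext => u; rewrite subrr mulr0.
Qed.

Lemma has_cderiv_sum (I : Type) (r : seq I) (h : I -> R -> C) s l :
  (forall i, has_cderiv (h i) s (l i)) ->
  has_cderiv (fun t => \sum_(i <- r) h i t) s (\sum_(i <- r) l i).
Proof.
move=> hl; elim: r => [|i r IH].
  rewrite big_nil (_ : (fun t => _) = fun=> 0); first exact: has_cderiv_cst.
  by apply/funext => t; rewrite big_nil.
rewrite big_cons (_ : (fun t => _) = fun t => h i t + \sum_(j <- r) h j t).
  exact: (@has_cderivD (h i) (fun t => \sum_(j <- r) h j t) s _ _ (hl i) IH).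
by apply/funext => t; rewrite big_cons.
Qed.

Lemma near_right_le (P : R -> Prop) : (\forall s \near 0^'+, P s) ->
  exists2 delta : R, 0 < delta <= 1 & forall s, 0 < s <= delta -> P s.
Proof.
move=> [e /= e0 He]; exists (Num.min (e / 2) 1) => [|s /andP[s0]].
  by rewrite lt_min ltr01 divr_gt0//= ge_min lexx orbT.
rewrite le_min => /andP[se _]; apply: He => //=.
rewrite sub0r normrN gtr0_norm// (le_lt_trans se)//.
by rewrite ltr_pdivrMr// ltr_pMr// ltr1n.
Qed.

Context {d : nat}.

Lemma eigenvalue_seq (B : 'M[C]_d) :
  exists r : seq C, forall z, eigenvalue B z = (z \in r).
Proof.
have [r rE] := closed_field_poly_normal (char_poly B); exists r => z.
by rewrite eigenvalue_root_char rE (monicP (char_poly_monic _)) scale1r root_prod_XsubC.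
Qed.

(** The gap between alpha and the real parts of the eigenvalues leaves room for
    an error eta both in the reduction of the residue to diagonal form and in
    the convergence to the residue. *)
Lemma system_growth (Z N : R -> 'M[C]_d) (B0 : 'M[C]_d) (alpha : R) :
  (0 < d)%N ->
  (forall s, 0 < s <= 1 -> forall i j,
     has_cderiv (fun t => Z t i j) s ((N s *m Z s) i j)) ->
  (s%:C *: N s) @[s --> 0^'+] --> B0 ->
  (forall z, eigenvalue B0 z -> alpha < Re z) ->
  exists c delta : R, [/\ 0 <= c, 0 < delta <= 1 &
    forall s, 0 < s <= delta -> forall i j, cmod (Z s i j) <= c * s `^ alpha].
Proof.
move=> d0 Zd NB Beig.
have [gam agam gamle] : exists2 gam, alpha < gam & forall z, eigenvalue B0 z -> gam <= Re z.
  have [r rE] := eigenvalue_seq B0.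
  have : forall z, z \in r -> alpha < Re z by move=> z; rewrite -rE; exact: Beig.
  suff : (forall z, z \in r -> alpha < Re z) ->
      exists2 gam, alpha < gam & forall z, z \in r -> gam <= Re z.
    by move=> H /H[g ag Hg]; exists g => // z; rewrite rE; exact: Hg.
  elim: r {rE} => [_|z r IH Hr]; first by exists (alpha + 1); rewrite ?ltrDl.
  have [|g ag Hg] := IH; first by move=> u ur; rewrite Hr// inE ur orbT.
  exists (Num.min g (Re z)) => [|u]; first by rewrite lt_min ag Hr// mem_head.
  rewrite inE => /predU1P[->|/Hg]; first by rewrite ge_min lexx orbT.
  by rewrite ge_min => ->.
pose D : R := 4 * d%:R + 1; have D0 : 0 < D by rewrite ltr_wpDl.
pose eta := (gam - alpha) / D; have eta0 : 0 < eta by rewrite divr_gt0// subr_gt0.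
have [S [Su Sdiag Soff]] := almost_diagonal B0 d0 eta0.
set L := S *m B0 *m invmx S in Sdiag Soff.
(* The matrix of the system in the new basis, multiplied by s. *)
pose K s := S *m (s%:C *: N s) *m invmx S.
have [delta d01 Kdelta] : exists2 delta : R, 0 < delta <= 1 &
    forall s, 0 < s <= delta -> forall i j, cmod (K s i j - L i j) <= eta.
  apply: near_right_le; apply: filter_forall => i; apply: filter_forall => j.
  have KL : K s i j @[s --> 0^'+] --> L i j.
    pose f (s : R) := \sum_k (\sum_l S i l * (s%:C *: N s) l k) * invmx S k j.
    rewrite (_ : (fun s => K s i j) = f); last first.
      by apply/funext => s; rewrite /K mxE; apply: eq_bigr => k _; rewrite mxE.
    rewrite (_ : L i j = \sum_k (\sum_l S i l * B0 l k) * invmx S k j); last first.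
      by rewrite /L mxE; apply: eq_bigr => k _; rewrite mxE.
    apply: cvg_big => [|k _]; first exact: add_continuous.
    apply: cvgM; last exact: cvg_cst.
    apply: cvg_big => [|l _]; first exact: add_continuous.
    apply: cvgM; first exact: cvg_cst.
    exact: cvg_mx_coord NB.
  have eta0' : 0 < eta%:C by rewrite ltcR.
  move/cvgrPdist_le : KL => /(_ _ eta0'); apply: filterS => s.
  by rewrite cmod_le distrC.
have yd s : 0 < s <= delta -> forall j i, has_cderiv (fun t => (S *m col j (Z t)) i 0) s
    ((s^-1)%:C * (K s *m (S *m col j (Z s))) i 0).
  move=> /andP[s0 sd] j i.
  have s01 : 0 < s <= 1 by rewrite s0 (le_trans sd)//; case/andP: d01.
  have H := @has_cderiv_sum _ (index_enum 'I_d) _ _ _ (fun k => has_cderivZ (c := S i k) (Zd s s01 k j)).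
  rewrite (_ : (fun t => _) = fun t => \sum_k S i k * Z t k j); last first.
    by apply/funext => t; rewrite mxE; apply: eq_bigr => k _; rewrite mxE.
  rewrite (_ : _ * _ = \sum_k S i k * (N s *m Z s) k j)//.
  rewrite /K -!mulmxA (mulmxA (invmx S)) mulVmx// mul1mx -scalemxAl -scalemxAr mxE mulrA.
  rewrite real_complexV mulVf ?mul1r; last by rewrite (inj_eq (@complexI _)) gt_eqF.
  rewrite mxE; apply: eq_bigr => k _; congr (_ * _).
  by rewrite !mxE; apply: eq_bigr => l _; rewrite mxE.
have Kd s : 0 < s <= delta -> forall i, alpha + 2 * d%:R * (2 * eta) <= Re (K s i i).
  move=> s0d i; have := le_trans (normr_Re_le _) (Kdelta s s0d i i).
  rewrite ReB => /ler_normlP[+ _]; rewrite opprB lerBlDr => KL.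
  have := gamle _ (Sdiag i); have : eta * D = gam - alpha by rewrite divfK// gt_eqF.
  rewrite /D; lra.
have Ko s : 0 < s <= delta -> forall i j, i != j -> cmod (K s i j) <= 2 * eta.
  move=> s0d i j ij; rewrite -(subrK (L i j) (K s i j)) (le_trans (cmodD _ _))//.
  by rewrite mulr_natl mulr2n lerD// ?Kdelta// Soff.
have /choice[c cP] : forall j, exists c : R, 0 <= c /\ forall s, 0 < s <= delta -> forall i,
    cmod ((S *m col j (Z s)) i 0) <= c * s `^ alpha.
  move=> j; have eta2 : 0 <= 2 * eta by rewrite mulr_ge0// ltW.
  have [c c0 cP] := energy_growth (proj1 (andP d01)) eta2 (fun s h => yd s h j) Kd Ko.
  by exists c.
pose b i := \sum_k cmod (invmx S i k).
have b0 i : 0 <= b i by apply: sumr_ge0 => k _; exact: cmod_ge0.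
exists (\sum_i \sum_j b i * c j), delta; split=> // [|s s0d i j].
  by apply: sumr_ge0 => i _; apply: sumr_ge0 => j _; rewrite mulr_ge0//; case: (cP j).
have bc0 i' j' : 0 <= b i' * c j' by rewrite mulr_ge0//; case: (cP j').
apply: (@le_trans _ _ (b i * c j * s `^ alpha)); last first.
  rewrite ler_wpM2r ?powR_ge0// (bigD1 i)//= (bigD1 j)//= -addrA lerDl.
  by rewrite addr_ge0 ?sumr_ge0// => *; rewrite sumr_ge0.
have -> : Z s i j = \sum_k invmx S i k * (S *m col j (Z s)) k 0.
  have -> : Z s i j = (invmx S *m (S *m col j (Z s))) i 0 by rewrite mulKmx// mxE.
  by rewrite mxE.
rewrite (le_trans (cmod_sum _ _))// /b -mulrA mulr_suml ler_sum// => k _.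
by rewrite cmodM ler_wpM2l ?cmod_ge0//; case: (cP j) => _; exact.
Qed.

End SystemGrowth.

(** * The fundamental theorem of calculus with a power singularity *)

Section ImproperIntegral.
Context {R : realType}.
Local Notation mu := (@lebesgue_measure R).

Lemma is_derive_continuous (U : R -> R) (s l : R) :
  is_derive s 1 U l -> {for s, continuous U}.
Proof. by move=> [/derivable1_diffP + _]; exact: differentiable_continuous. Qed.

Lemma within_continuous_itv (u : R -> R) (i : interval R) :
  (forall s, s \in i -> {for s, continuous u}) -> {within [set` i], continuous u}.
Proof.
move=> uc; apply/subspace_continuousP => s /= si.
exact: cvg_within_filter (uc s si).
Qed.

Lemma FTC2_of_derive (u U : R -> R) (a b : R) : a < b ->
  (forall s, a <= s <= b -> is_derive s 1 U (u s)) ->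
  (forall s, a <= s <= b -> {for s, continuous u}) ->
  (\int[mu]_(s in `[a, b]) (u s)%:E = (U b)%:E - (U a)%:E)%E.
Proof.
move=> ab Ud uc; apply: continuous_FTC2 => //.
- by apply: within_continuous_itv => s; rewrite in_itv/=; exact: uc.
- split.
  + move=> s; rewrite in_itv/= => /andP[/ltW sa /ltW sb].
    by apply: (@ex_derive _ _ _ _ _ _ _ (Ud s _)); rewrite sa.
  + apply/cvg_at_right_filter/(is_derive_continuous (Ud a _)).
    by rewrite lexx ltW.
  + apply/cvg_at_left_filter/(is_derive_continuous (Ud b _)).
    by rewrite lexx ltW.
- move=> s; rewrite in_itv/= => /andP[/ltW sa /ltW sb].
  by rewrite derive1E; apply: (@derive_val _ _ _ _ _ _ _ (Ud s _)); rewrite sa.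
Qed.

(** Monotone convergence along the intervals from 1 / (n + 1) to 1. *)
Lemma integrable_powR01 (beta : R) : -1 < beta ->
  mu.-integrable `]0, 1] (fun s => (s `^ beta)%:E).
Proof.
move=> beta1; have b0 : 0 < beta + 1 by rewrite -ltrBlDr sub0r.
pose U (s : R) := (beta + 1)^-1 * s `^ (beta + 1).
have Ud (s : R) : 0 < s -> is_derive s 1 U (s `^ beta).
  move=> s0; have := is_deriveZ ((beta + 1)^-1) (is_derive1_powR (beta + 1) s0).
  move=> H; apply: is_derive_eq H _.
  by rewrite /GRing.scale /= mulrA mulVf ?gt_eqF// mul1r addrK.
have pc (s : R) : 0 < s -> {for s, continuous (@powR R ^~ beta)}.
  by move=> s0; exact: is_derive_continuous (is_derive1_powR beta s0).
have mpow (D : set R) : measurable_fun D (fun s : R => s `^ beta).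
  by apply: measurable_funTS.
apply/integrableP; split; first by apply/measurable_EFinP; apply: mpow.
pose F (n : nat) := `[(0 + n.+1%:R^-1 : R), 1]%classic.
have Fpos n s : F n s -> 0 < s.
  by rewrite /F/= in_itv/= add0r => /andP[+ _]; apply: lt_le_trans; rewrite invr_gt0.
have ndF : nondecreasing_seq F.
  move=> m n mn; apply/subsetPset; apply: subset_itvr; rewrite bnd_simp !add0r.
  by rewrite lef_pV2 ?posrE ?ltr0n// ler_nat.
have limF : (\int[mu]_(s in F n) (s `^ beta)%:E @[n --> \oo] -->
    \int[mu]_(s in \bigcup_n F n) (s `^ beta)%:E)%E.
  apply: ge0_nondecreasing_set_cvg_integral => //.
  - by move=> n; exact: measurable_itv.
  - by move=> n; apply/measurable_EFinP; exact: mpow.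
  - by move=> n s _; rewrite lee_fin powR_ge0.
have IF n : (\int[mu]_(s in F n) (s `^ beta)%:E <= (U 1)%:E)%E.
  have U0 (s : R) : 0 <= U s by rewrite mulr_ge0 ?powR_ge0// invr_ge0 ltW.
  case: n => [|n].
    by rewrite /F add0r invr1 set_itv1 integral_set1 lee_fin.
  have n1 : 0 + n.+2%:R^-1 < 1 :> R by rewrite add0r invf_lt1// ltr1n.
  have sF (s : R) : 0 + n.+2%:R^-1 <= s <= 1 -> 0 < s.
    by move=> sF; apply: (Fpos n.+1); rewrite /F /= in_itv.
  rewrite /F (FTC2_of_derive n1 (fun s h => Ud s (sF s h)) (fun s h => pc s (sF s h))).
  by rewrite -EFinB lee_fin gerBl.
have -> : (\int[mu]_(s in `]0%R, 1%R]) `|(s `^ beta)%:E| =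
           \int[mu]_(s in \bigcup_n F n) (s `^ beta)%:E)%E.
  rewrite -itv_open_bnd_bigcup; apply: eq_integral => s _.
  by rewrite abse_EFin ger0_norm// powR_ge0.
apply: le_lt_trans (ltry (U 1)).
rewrite -(cvg_lim _ limF)//; apply: lime_le.
  by apply/cvg_ex; eexists; exact: limF.
by apply: nearW => n; exact: IF.
Qed.

(** Domination by an integrable power makes u integrable up to 0, so that its
    integral from e to 1, which is U 1 - U e, tends to the one from 0 to 1. *)
Lemma improper_FTC (u U : R -> R) (beta c delta : R) : -1 < beta ->
  0 < delta <= 1 ->
  (forall s : R, 0 < s <= 1 -> is_derive s 1 U (u s)) ->
  (forall s : R, 0 < s <= 1 -> {for s, continuous u}) ->
  (forall s : R, 0 < s <= delta -> `|u s| <= c * s `^ beta) ->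
  U s @[s --> 0^'+] --> 0 ->
  mu.-integrable `]0, 1] (EFin \o u) /\ \int[mu]_(s in `]0, 1]) u s = U 1.
Proof.
move=> beta1 /andP[d0 d1] Ud uc ub U0.
have [K K0 Kb] : exists2 K : R, 0 <= K & forall s, delta <= s <= 1 -> `|u s| <= K.
  have cu : {within `[delta, 1], continuous (fun s => `|u s|)}.
    apply: within_continuous_itv => s; rewrite in_itv/= => /andP[sd s1].
    apply: (@continuous_comp _ _ _ u (fun x => `|x|)); last exact: norm_continuous.
    by apply: uc; rewrite (lt_le_trans d0 sd).
  have [m _ mP] := EVT_max d1 cu.
  by exists `|u m| => // s sd1; apply: mP; rewrite in_itv.
have uint : mu.-integrable `]0, 1] (EFin \o u).
  pose g (s : R) := (c%:E * (s `^ beta)%R%:E + K%:E * (s `^ 0)%R%:E)%E.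
  apply: (@le_integrable _ _ _ mu _ _ _ g) => //.
  - apply/measurable_EFinP; apply: subspace_continuous_measurable_fun => //.
    by apply: within_continuous_itv => s; rewrite in_itv/=; exact: uc.
  - move=> s; rewrite /= in_itv/= => /andP[s0 s1].
    rewrite lee_fin powRr0 mulr1 (le_trans _ (ler_norm _))//.
    have [sd|/ltW sd] := leP s delta.
      by rewrite (le_trans (ub s _)) ?s0// lerDl.
    rewrite (le_trans (Kb s _)) ?sd// lerDr.
    have cd : 0 <= c * delta `^ beta.
      by apply: le_trans (ub delta _); rewrite ?d0/=.
    have c0 : 0 <= c by rewrite -(pmulr_lge0 _ (powR_gt0 beta d0)).
    by rewrite mulr_ge0// powR_ge0.
  - by apply: integrableD => //; apply: integrableZl => //; apply: integrable_powR01 => //; rewrite ltrN10.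
split=> //; rewrite Rintegral_itv_obnd_cbnd//.
have uint' : mu.-integrable `[0, 1] (EFin \o u).
  have /integrableP[mu0 ufin] := uint.
  apply/integrableP; split; first exact/emeasurable_fun_itv_obnd_cbndP.
  rewrite -integral_itv_obnd_cbnd//; exact: measurableT_comp.
have J0 := parameterized_integral_cvg_left ltr01 uint'.
have E : {near (0:R)^'+, (fun e => parameterized_integral mu 0 e u + (U 1 - U e)) =1
    fun=> \int[mu]_(s in `[0, 1]) u s}.
  near=> e; have e0 : 0 < e by near: e; exact: nbhs_right_gt.
  have e1 : e < 1 by near: e; exact: nbhs_right_lt.
  apply/eqP; rewrite addrC eq_sym -subr_eq /parameterized_integral.
  rewrite Rintegral_itvB ?bnd_simp ?ltW// Rintegral_itv_obnd_cbnd.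
    have e01 s : e <= s <= 1 -> 0 < s <= 1.
      by move=> /andP[es ->]; rewrite (lt_le_trans e0 es).
    rewrite /Rintegral.
    by rewrite (FTC2_of_derive e1 (fun s h => Ud s (e01 s h)) (fun s h => uc s (e01 s h))).
  by apply: integrableS uint => //; apply: subset_itvr; rewrite bnd_simp ltW.
have L : parameterized_integral mu 0 e u + (U 1 - U e) @[e --> 0^'+] --> 0 + (U 1 - 0).
  apply: cvgD; first exact: cvg_at_right_filter J0.
  by apply: cvgB => //; exact: cvg_cst.
have L' : (fun=> \int[mu]_(s in `[0, 1]) u s) e @[e --> (0 : R)^'+] --> 0 + (U 1 - 0).
  by apply: cvg_trans L; exact: near_eq_cvg.
rewrite add0r subr0 in L'; rewrite -(cvg_lim (@Rhausdorff R) L') lim_cst//.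
Unshelve. all: by end_near. Qed.

End ImproperIntegral.

(** * The residue of the system along a path *)

Section Eigenvalues.
Context {F : fieldType} {d : nat}.
Implicit Types (A : 'M[F]_d).

Lemma eigenvalue_trmx A (z : F) : eigenvalue A^T z = eigenvalue A z.
Proof.
rewrite /eigenvalue /eigenspace !kermx_eq0 !row_free_unit -[in RHS]unitmx_tr.
by rewrite linearB /= tr_scalar_mx.
Qed.

Lemma eigenvalueN A (z : F) : eigenvalue (- A) z -> eigenvalue A (- z).
Proof.
move=> /eigenvalueP[v vA v0]; apply/eigenvalueP; exists v => //.
by rewrite scaleNr -vA mulmxN opprK.
Qed.

Lemma eigenvalue_subr_scalar A (c z : F) :
  eigenvalue (A - c%:M) z -> eigenvalue A (z + c).
Proof.
move=> /eigenvalueP[v vA v0]; apply/eigenvalueP; exists v => //.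
by rewrite scalerDl -vA mulmxBr mul_mx_scalar subrK.
Qed.

End Eigenvalues.

(** The limit of the system multiplied by s, in the form v / q (..) where v is
    the velocity, q is (g + 1) / s and y is the path; both v and q tend to the
    initial velocity. *)
Lemma cvg_residue (K : numFieldType) (d : nat) (T : Type) (F : set_system T)
    {FF : Filter F} (v q y : T -> K) (v0 c : K) (A B : 'M[K]_d) :
  v0 != 0 -> v @ F --> v0 -> q @ F --> v0 -> y @ F --> (-1 : K) ->
  (v t / q t) *: (((y t + 1) / (y t - 1)) *: A + B
                  - (2 * y t / (y t - 1) * c)%:M) @[t --> F] --> B - c%:M.
Proof.
move=> v00 vv qv yN; have m2 : -1 - 1 != 0 :> K.
  by rewrite -opprD oppr_eq0 -(natrD _ 1 1) pnatr_eq0.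
have ym : (y t - 1)^-1 @[t --> F] --> (-1 - 1 : K)^-1.
  by apply: cvgV => //; apply: cvgB => //; exact: cvg_cst.
apply: cvg_mx => i j.
rewrite (_ : (B - _) i j = v0 / v0 * ((-1 + 1) * (-1 - 1)^-1 * A i j + B i j
    - (2 * -1 * (-1 - 1)^-1 * c) *+ (i == j))); last first.
  rewrite !mxE addNr !mul0r add0r divff// mul1r; congr (_ - _ *+ _).
  by rewrite (_ : 2 * -1 = -1 - 1) ?divff ?mul1r//; ring.
rewrite (_ : (fun t => _) = fun t => v t / q t * ((y t + 1) / (y t - 1) * A i j + B i j
    - (2 * y t / (y t - 1) * c) *+ (i == j))); last first.
  by apply/funext => t; rewrite !mxE.
apply: cvgM; first by apply: cvgM => //; exact: cvgV.
apply: cvgB.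
  apply: cvgD; last exact: cvg_cst.
  apply: cvgM; last exact: cvg_cst.
  by apply: cvgM => //; apply: cvgD => //; exact: cvg_cst.
case: (i == j); last by under eq_fun do rewrite mulr0n; rewrite mulr0n; exact: cvg_cst.
under eq_fun do rewrite mulr1n; rewrite mulr1n.
apply: cvgM; last exact: cvg_cst.
by apply: cvgM => //; apply: cvgM => //; exact: cvg_cst.
Qed.

Section ResidueLimit.
Context {R : realType} {d : nat}.
Local Notation C := R[i].
Local Notation Re := complex.Re.
Local Notation Im := complex.Im.
Implicit Types (A B : 'M[C]_d).

Lemma path_has_cderiv (g : R -> C) (s : R) :
  derivable (fun t => Re (g t)) s 1 -> derivable (fun t => Im (g t)) s 1 ->
  has_cderiv g s (velocity g s).
Proof.
move=> /derivableP gR /derivableP gI; rewrite -derive1E in gR; rewrite -derive1E in gI.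
by apply/has_cderivP; split; [exact: gR|exact: gI].
Qed.

(** Along a path leaving -1 with nonzero velocity, g' / (g + 1) is asymptotic
    to 1 / s, so that s times the pulled back connection tends to its residue
    at -1. *)
Lemma residue_limit n A B (g : R -> C) x : (1 < n)%N -> path_from_m1 g x ->
  (s%:C *: (velocity g s *: Mtilde A B n (g s)) : 'M[C]_d) @[s --> 0^'+] -->
  (B - ((n%:R - 1)^-1)%:M : 'M[C]_d).
Proof.
move=> n1 [g0 _ gne [gd vc] v0].
have gder s : has_cderiv g s (velocity g s) by case: (gd s) => *; exact: path_has_cderiv.
have n10 : n%:R - 1 != 0 :> C by rewrite subr_eq0 pnatr_eq1 gtn_eqF.
have gc : g s @[s --> 0^'+] --> (-1 : C).
  by rewrite -g0; apply: cvg_at_right_filter; exact: has_cderiv_continuous (gder 0).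
have vc0 : velocity g s @[s --> 0^'+] --> velocity g 0 by exact: cvg_at_right_filter (vc 0).
have quot : ((s%:C)^-1 * (g s + 1) : C) @[s --> 0^'+] --> velocity g 0.
  rewrite (_ : (fun s : R => _) = fun s : R => (s%:C)^-1 * (g (s + 0) - g 0)).
    exact: cvg_dnbhs_at_right (gder 0).
  by apply/funext => s; rewrite addr0 g0 opprK.
have LB : ((velocity g s / ((s%:C)^-1 * (g s + 1))) *: (((g s + 1) / (g s - 1)) *: A + B
    - (2 * g s / (g s - 1) * (n%:R - 1)^-1)%:M) : 'M[C]_d) @[s --> 0^'+] -->
    (B - ((n%:R - 1)^-1)%:M : 'M[C]_d).
  by apply: cvg_residue; [exact: v0|exact: vc0|exact: quot|exact: gc].
apply: cvg_trans LB; apply: near_eq_cvg; near=> s.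
have s0 : 0 < s by near: s; exact: nbhs_right_gt.
have s1 : s <= 1 by near: s; exact: nbhs_right_le.
have [g1 gN1] : g s != 1 /\ g s != -1 by apply: gne; rewrite s0.
have gm0 : g s - 1 != 0 by rewrite subr_eq0.
have gp0 : g s + 1 != 0 by rewrite -(opprK 1) subr_eq0.
have sC0 : s%:C != 0 by rewrite (inj_eq (@complexI _)) gt_eqF.
rewrite /Mtilde /Msys (_ : Qpol (g s) = (g s - 1) * (g s + 1)); last by rewrite /Qpol; ring.
move: (g s) (velocity g s) s%:C gm0 gp0 sC0 => y v t ym yp t0.
apply/matrixP => i j; rewrite !mxE.
by case: (i == j); rewrite ?mulr1n ?mulr0n; field; rewrite ?ym ?yp ?t0 ?n10.
Unshelve. all: by end_near. Qed.

End ResidueLimit.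

(** * The integral relation along a path *)

Lemma eq_integral01 (R : realType) (f h : R -> R) (v : R) :
  (forall s, 0 < s <= 1 -> f s = h s) ->
  lebesgue_measure.-integrable `]0, 1] (EFin \o f) /\
    \int[lebesgue_measure]_(s in `]0, 1]) f s = v ->
  lebesgue_measure.-integrable `]0, 1] (EFin \o h) /\
    \int[lebesgue_measure]_(s in `]0, 1]) h s = v.
Proof.
move=> fh [fi fv]; split.
  refine (eq_integrable _ _ _ _ fi); first exact: measurable_itv.
  by move=> s; rewrite inE /= in_itv /= => s01; rewrite /= fh.
rewrite -fv; apply: eq_Rintegral => s; rewrite inE /= in_itv /= => s01.
by rewrite fh.
Qed.

Section IntegralAlongPath.
Context {R : realType} {d n : nat}.
Local Notation C := R[i].
Local Notation Re := complex.Re.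
Local Notation Im := complex.Im.
Local Notation lifted q := (lift_vars (fun i => mpoly_of_dhomog (q i))).
Context (A B : 'M[C]_d) (e : C) (g : R -> C) (x : C) (Y : R -> C -> 'M[C]_d).
Context (d0 : (0 < d)%N) (n1 : (1 < n)%N) (gpath : path_from_m1 g x)
  (Ycont : continued_along (Mtilde A (B + e%:M) n) g Y).

(** The continued fundamental matrix as a function of the parameter, extended
    beyond 1 by its last germ so that derivatives are two-sided. *)
Definition solution_along (s : R) : 'M[C]_d := Y (Num.min s 1) (g s).
Local Notation Z := solution_along.
Local Notation M := (Mtilde A (B + e%:M) n).

Lemma solution_alongE s : s <= 1 -> Z s = Y s (g s).
Proof. by move=> s1; rewrite /solution_along min_l. Qed.

Lemma path_cderiv s : has_cderiv g s (velocity g s).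
Proof. by have [_ _ _ [gd _] _] := gpath; have [] := gd s; exact: path_has_cderiv. Qed.

(** Nearby germs agree, and past 1 the germ at 1 itself is used. *)
Lemma near_solution_along (s0 : R) : 0 < s0 <= 1 -> \forall s \near s0, Z s = Y s0 (g s).
Proof.
move=> s01; have [_ Ynear] := Ycont s01; have /andP[s0gt s0le] := s01.
have pos : \forall s \near s0, 0 < s by exact: lt_nbhsr.
have below : \forall s \near s0, s0 < 1 -> s < 1.
  have [lt1|_] := ltP s0 1; last by apply: filterS pos.
  by apply: filterS (lt_nbhsl lt1) => s + _.
apply: filterS3 pos below Ynear => s sgt sbelow Ys.
have [s1|s1] := leP s 1.
  have sgt1 : 0 < s <= 1 by rewrite sgt.
  by rewrite solution_alongE//; exact: nbhs_singleton (Ys sgt1).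
rewrite /solution_along min_r ?ltW//; congr (Y _ _); apply/eqP.
rewrite eq_le s0le andbT leNgt; apply/negP => /sbelow.
by rewrite ltNge (ltW s1).
Qed.

(** A holomorphic expression in the germ of the fundamental matrix is
    differentiable along the path. *)
Lemma germ_cderiv (m p : nat) (f : C -> 'M[C]_d -> 'M[C]_(m, p)) (s : R) l i j :
  0 < s <= 1 -> is_derive (g s) 1 (fun z => f z (Y s z)) l ->
  has_cderiv (fun t => f (g t) (Z t) i j) s (l i j * velocity g s).
Proof.
move=> s01 /is_derive_mxP /(_ i j) fd.
have gs : has_cderiv g s (velocity g s) by exact: path_cderiv.
apply: near_eq_has_cderiv (has_cderiv_comp fd gs).
by apply: filterS (near_solution_along s01) => t ->.
Qed.

Lemma fundamental_along (s : R) : 0 < s <= 1 ->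
  (\forall z \near g s, Y s z \in unitmx) /\ is_derive (g s) 1 (Y s) (M (g s) *m Y s (g s)).
Proof.
move=> s01; have [Yf _] := Ycont s01; split; first by apply: filterS Yf => z [].
by have [] := nbhs_singleton Yf.
Qed.

Lemma solution_along_cderiv (s : R) : 0 < s <= 1 -> forall i j,
  has_cderiv (fun t => Z t i j) s (((velocity g s *: M (g s)) *m Z s) i j).
Proof.
move=> s01 i j; have [_ Yd] := fundamental_along s01.
have H := @germ_cderiv d d (fun _ X => X) s _ i j s01 Yd.
rewrite solution_alongE; last by case/andP: s01.
by rewrite -scalemxAl [X in has_cderiv _ _ X]mxE mulrC.
Qed.

Lemma inverse_along_cderiv (s : R) : 0 < s <= 1 -> forall i j,
  has_cderiv (fun t => (invmx (Z t))^T i j) s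
    (((velocity g s *: - (M (g s))^T) *m (invmx (Z s))^T) i j).
Proof.
move=> s01 i j; have [Yu Yd] := fundamental_along s01.
have H := @germ_cderiv d d (fun _ X => invmx X) s _ j i s01 (is_derive_invmx Yu Yd).
rewrite solution_alongE; last by case/andP: s01.
have Yus := nbhs_singleton Yu.
rewrite (_ : (fun t => _) = fun t => invmx (Z t) j i); last by apply/funext => t; rewrite mxE.
rewrite (_ : (_ *m _) i j = (- (invmx (Y s (g s)) *m (M (g s) *m Y s (g s)) *m invmx (Y s (g s)))) j i * velocity g s)//.
rewrite -!mulmxA mulmxV// mulmx1 -scalemxAl mulNmx -trmx_mul !mxE mulrC.
by [].
Qed.

Lemma residue_along : (s%:C *: (velocity g s *: M (g s)) : 'M[C]_d) @[s --> 0^'+] -->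
  (B + e%:M - ((n%:R - 1)^-1)%:M : 'M[C]_d).
Proof. exact: residue_limit n1 gpath. Qed.

Lemma solution_along_growth (alpha : R) :
  (forall z, eigenvalue (B + e%:M) z -> alpha + (n%:R - 1)^-1 < Re z) ->
  exists c delta : R, [/\ 0 <= c, 0 < delta <= 1 &
    forall s, 0 < s <= delta -> forall i j, cmod (Z s i j) <= c * s `^ alpha].
Proof.
move=> Beig.
apply: (system_growth d0 solution_along_cderiv residue_along).
move=> z /eigenvalue_subr_scalar /Beig.
have -> : (n%:R - 1)^-1 = ((n%:R - 1)^-1 : R)%:C :> C.
  by rewrite real_complexV rmorphB rmorph_nat rmorph1.
by rewrite ReD /= ltrD2r.
Qed.

(** The inverse transpose solves the dual system, whose residue has the
    opposite eigenvalues. *)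
Lemma inverse_along_growth (alpha : R) :
  (forall z, eigenvalue (B + e%:M) z -> Re z < (n%:R - 1)^-1 - alpha) ->
  exists c delta : R, [/\ 0 <= c, 0 < delta <= 1 &
    forall s, 0 < s <= delta -> forall i j, cmod (invmx (Z s) i j) <= c * s `^ alpha].
Proof.
move=> Beig.
have lim : (s%:C *: (velocity g s *: - (M (g s))^T) : 'M[C]_d) @[s --> 0^'+] -->
    (- (B + e%:M - ((n%:R - 1)^-1)%:M)^T : 'M[C]_d).
  apply: cvg_mx => i j.
  have H : (s%:C *: (velocity g s *: M (g s))) j i @[s --> 0^'+] -->
      (B + e%:M - ((n%:R - 1)^-1)%:M) j i by exact: cvg_mx_coord residue_along.
  rewrite (_ : (fun s => _) = fun s => - (s%:C *: (velocity g s *: M (g s))) j i).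
    by rewrite [X in _ --> X]mxE [in X in _ --> X]mxE; apply: cvgN; exact: H.
  by apply/funext => s; rewrite !mxE !mulrN.
have [|c [delta [c0 d01 H]]] := system_growth (alpha := alpha) d0 inverse_along_cderiv lim.
  move=> z /eigenvalueN; rewrite eigenvalue_trmx => /eigenvalue_subr_scalar /Beig.
  have -> : (n%:R - 1)^-1 = ((n%:R - 1)^-1 : R)%:C :> C.
    by rewrite real_complexV rmorphB rmorph_nat rmorph1.
  by rewrite ReD (_ : Re (- z) = - Re z) /=; [lra|case: z].
exists c, delta; split=> // s s0d i j.
by have := H s s0d j i; rewrite mxE.
Qed.

Context (q : @Pspace R d n) (k : nat) (w : 'cV[C]_d).
Local Notation r := (rodrigues (coef_poly A B) k (lifted q) k).
Local Notation r' := (rodrigues_step (coef_poly A B) 0 r).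
Local Notation v := (invmx (Y 1 (g 1)) *m w).

Let r_homogeneous : homogeneous n r.
Proof.
by apply: homogeneous_rodrigues; [exact: coef_poly_indep|exact: homogeneous_lift_vars].
Qed.

Let r'_homogeneous : homogeneous n r'.
Proof. by apply: homogeneous_step; [exact: coef_poly_indep|exact: r_homogeneous]. Qed.

Definition pullback (p : 'cV[mpoly (2 + d) C]_d) (s : R) : 'cV[C]_d :=
  invmx (Z s) *m evalmx p (g s) e (Z s *m v).

Lemma path_neq (s : R) : 0 < s <= 1 -> g s != 1 /\ g s != -1.
Proof. by move=> s01; have [_ _ gne _ _] := gpath; exact: gne. Qed.

Lemma integrand_along (s : R) : 0 < s <= 1 ->
  integrand Y g k.+1 (Peval q) w s = velocity g s *: pullback r' s.
Proof.
move=> s01; have [g1 gN1] := path_neq s01; have [Yf _] := Ycont s01.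
rewrite /integrand /pullback solution_alongE; last by case/andP: s01.
by rewrite (Pop_Mtilde q k _ n1 g1 gN1 Yf) -mulmxA.
Qed.

Lemma pullback_continuous p (s : R) i : 0 < s <= 1 ->
  {for s, continuous (fun t => pullback p t i 0)}.
Proof.
move=> s01; have [Yu Yd] := fundamental_along s01.
have vd := is_derive_mulmx Yd (is_derive_cst v (g s) 1).
have pd := is_derive_evalmx p (is_derive_id (g s) 1) (is_derive_cst e (g s) 1) vd.
have D := is_derive_mulmx (is_derive_invmx Yu Yd) pd.
have H := @germ_cderiv d 1 (fun z X => invmx X *m evalmx p z e (X *m v)) s _ i 0 s01 D.
exact: has_cderiv_continuous H.
Qed.

(** In the recursion of the tilde system the last step has constant 1, so it is
    the derivative of Q times the pullback of P_k q. *)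
Lemma primitive_cderiv (s : R) i : 0 < s <= 1 ->
  has_cderiv (fun t => (Qpol (g t) *: pullback r t) i 0) s
    ((velocity g s *: pullback r' s) i 0).
Proof.
move=> s01; have [g1 gN1] := path_neq s01; have [Yu Yd] := fundamental_along s01.
have GM : (g s ^+ 2 - 1) *: M (g s) = evalmx (coef_poly_tilde n A B) (g s) e (Y s (g s) *m v).
  by rewrite -(Qpol_Mtilde A B e _ n1 g1 gN1).
have D := is_derive_pullback 0 r GM Yu Yd.
have H := @germ_cderiv d 1 (fun z X => (z ^+ 2 - 1) ^+ 1 *: (invmx X *m evalmx r z e (X *m v)))
  s _ i 0 s01 D.
refine (eq_ind _ (has_cderiv _ s) H _ _).
rewrite expr0 scale1r (step_shift _ _ n1 r_homogeneous) [RHS]mxE mulrC /pullback.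
by rewrite solution_alongE//; case/andP: s01.
Qed.

Context (a b : R) (eig_ge : forall z, eigenvalue (B + e%:M) z -> a <= Re z)
  (eig_le : forall z, eigenvalue (B + e%:M) z -> Re z <= b) (ab : 0 < n%:R * a - b).

(* Half of the gap n a - b is spent in the growth estimates. *)
Let beta : R := (n%:R * a - b) / 2 - 1.

Let beta_gt : -1 < beta.
Proof. by rewrite /beta ltrBrDr addrC subrr divr_gt0. Qed.

(** The crude bounds Y = O(s^alpha1) and Y^-1 = O(s^alpha2) suffice, as the
    exponents enter the convergence condition only through their extreme real
    parts. *)
Lemma pullback_bound p : homogeneous n p ->
  exists c delta : R, [/\ 0 <= c, 0 < delta <= 1 &
    forall s, 0 < s <= delta -> forall i, cmod (pullback p s i 0) <= c * s `^ beta].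
Proof.
move=> ph; pose theta : R := (n%:R * a - b) / (2 * (n%:R + 1)).
have n0 : 0 < n%:R + 1 :> R by rewrite ltr_wpDl.
have theta0 : 0 < theta by rewrite divr_gt0// mulr_gt0.
(* The residue is shifted by nu; in n alpha1 + alpha2 this contributes -1. *)
pose nu : R := (n%:R - 1)^-1.
pose alpha1 := a - nu - theta; pose alpha2 := nu - b - theta.
have betaE : beta = alpha1 * n%:R + alpha2.
  have n10 : n%:R - 1 != 0 :> R by rewrite subr_eq0 pnatr_eq1 gtn_eqF.
  rewrite /beta /alpha1 /alpha2 /theta /nu; field.
  by rewrite n10 gt_eqF.
have [|c1 [d1 [c10 d11 H1]]] := @solution_along_growth alpha1.
  by move=> z /eig_ge; rewrite /alpha1 -/nu; lra.
have [|c2 [d2 [c20 d21 H2]]] := @inverse_along_growth alpha2.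
  by move=> z /eig_le; rewrite /alpha2 -/nu; lra.
pose rho : R := 2 + cmod e.
have [c3 [c30 H3]] : exists c3 : R, 0 <= c3 /\ forall (y : C) (u : 'cV[C]_d) (s : R),
    cmod y <= rho -> 0 <= s ->
    (forall l, cmod (u l 0) <= s) -> forall i, cmod (evalmx p y e u i 0) <= c3 * s ^+ n.
  have [c3 c30 H3] := norm_evalmx_le rho%:C ph.
  have c3E : c3 = (Re c3)%:C by move: c30; rewrite lecE => /andP[/eqP /= I0 _]; case: c3 I0 {H3} => ? ? /= ->.
  exists (Re c3); split=> [|y u s yr s0 us i].
    by rewrite -lecR -c3E.
  rewrite cmod_le rmorphM rmorphXn /= -c3E; apply: H3; rewrite -?cmod_le//.
  - by rewrite /rho lerDr.
  - by rewrite ler0c.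
  - by move=> l; rewrite -cmod_le.
pose V := \sum_m cmod (v m 0).
have V0 : 0 <= V by apply: sumr_ge0 => m _; exact: cmod_ge0.
have [d3 d31 H4] : exists2 delta : R, 0 < delta <= 1 & forall s, 0 < s <= delta -> cmod (g s) <= rho.
  apply: near_right_le.
  have gc : g s @[s --> 0^'+] --> g 0.
    by apply: cvg_at_right_filter; apply: has_cderiv_continuous; exact: path_cderiv.
  have one : 0 < (1 : R)%:C by rewrite ltcR.
  move/cvgrPdist_le : gc => /(_ _ one); apply: filterS => s; rewrite distrC -cmod_le => gs.
  have [g0 _ _ _ _] := gpath; rewrite g0 in gs.
  have cmodN1 : cmod (-1 : C) = 1 by rewrite /cmod normrN normr1.
  rewrite -(subrK (-1) (g s)) (le_trans (cmodD _ _))// cmodN1 /rho.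
  by rewrite (le_trans (lerD gs (lexx _)))// lerDl cmod_ge0.
exists (d%:R * (c2 * (c3 * (c1 * V) ^+ n))), (Num.min d1 (Num.min d2 d3)); split.
- by rewrite !mulr_ge0// exprn_ge0// mulr_ge0.
- move: d11 d21 d31 => /andP[d1p d11] /andP[d2p _] /andP[d3p _].
  by rewrite !lt_min d1p d2p d3p /= ge_min d11.
move=> s /andP[s0]; rewrite !le_min => /and3P[sd1 sd2 sd3] i.
have Zv l : cmod ((Z s *m v) l 0) <= c1 * V * s `^ alpha1.
  rewrite mxE (le_trans (cmod_sum _ _))// mulrAC /V mulr_sumr ler_sum// => m _.
  by rewrite cmodM ler_wpM2r ?cmod_ge0// H1 ?s0.
rewrite /pullback mxE (le_trans (cmod_sum _ _))//.
apply: (@le_trans _ _ (\sum_(j < d) c2 * s `^ alpha2 * (c3 * (c1 * V * s `^ alpha1) ^+ n))).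
  apply: ler_sum => j _; rewrite cmodM ler_pM ?cmod_ge0//; first by apply: H2; rewrite s0.
  apply: H3 => //; first by apply: H4; rewrite s0.
  by rewrite mulr_ge0 ?powR_ge0// mulr_ge0.
rewrite betaE; clearbody alpha1 alpha2.
rewrite [s `^ (_ + _)]powRD; last by rewrite (gt_eqF s0) implybT.
rewrite powRrM powR_mulrn ?powR_ge0// sumr_const card_ord -[leLHS]mulr_natl.
by rewrite [(c1 * V * _) ^+ n]exprMn le_eqVlt; apply/orP; left; apply/eqP; ring.
Qed.

Lemma velocity_bound : exists c delta : R, [/\ 0 <= c, 0 < delta <= 1 &
  forall s, 0 < s <= delta -> cmod (velocity g s) <= c].
Proof.
have [_ _ _ [_ vc] _] := gpath.
have vc0 : velocity g s @[s --> 0^'+] --> velocity g 0.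
  by apply: cvg_at_right_filter; exact: vc.
have one : 0 < (1 : R)%:C by rewrite ltcR.
have [delta d01 H] : exists2 delta : R, 0 < delta <= 1 &
    forall s, 0 < s <= delta -> cmod (velocity g s) <= 1 + cmod (velocity g 0).
  apply: near_right_le; move/cvgrPdist_le : vc0 => /(_ _ one); apply: filterS => s.
  rewrite distrC -cmod_le => vs.
  by rewrite -(subrK (velocity g 0) (velocity g s)) (le_trans (cmodD _ _))// lerD2r.
exists (1 + cmod (velocity g 0)), delta; split=> //.
by rewrite addr_ge0// cmod_ge0.
Qed.

Lemma Qpol_path_bound : exists c delta : R, [/\ 0 <= c, 0 < delta <= 1 &
  forall s, 0 < s <= delta -> cmod (Qpol (g s)) <= c * s].
Proof.
have [g0 _ _ _ _] := gpath.
have one : 0 < (1 : R)%:C by rewrite ltcR.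
have gder : has_cderiv g 0 (velocity g 0) by exact: path_cderiv.
have gc : g s @[s --> 0^'+] --> g 0.
  by apply: cvg_at_right_filter; exact: has_cderiv_continuous gder.
have quot : ((s%:C)^-1 * (g (s + 0) - g 0) : C) @[s --> 0^'+] --> velocity g 0.
  exact: cvg_dnbhs_at_right gder.
pose c := 1 + cmod (velocity g 0).
have [d1 d11 H1] : exists2 delta : R, 0 < delta <= 1 &
    forall s, 0 < s <= delta -> cmod ((s%:C)^-1 * (g (s + 0) - g 0)) <= c.
  apply: near_right_le; move/cvgrPdist_le : quot => /(_ _ one); apply: filterS => s.
  rewrite distrC -cmod_le => vs; rewrite -(subrK (velocity g 0) (_^-1 * _)).
  by rewrite (le_trans (cmodD _ _))// lerD2r.
have [d2 d21 H2] : exists2 delta : R, 0 < delta <= 1 &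
    forall s, 0 < s <= delta -> cmod (g s - g 0) <= 1.
  apply: near_right_le; move/cvgrPdist_le : gc => /(_ _ one); apply: filterS => s.
  by rewrite distrC -cmod_le.
have c0 : 0 <= c by rewrite addr_ge0// cmod_ge0.
exists (3 * c), (Num.min d1 d2); split; first by rewrite mulr_ge0.
  by move: d11 d21 => /andP[d1p d11] /andP[d2p _]; rewrite lt_min d1p d2p ge_min d11.
move=> s /andP[s0]; rewrite le_min => /andP[sd1 sd2].
have := H1 s; rewrite s0 sd1 addr0 -real_complexV cmodM cmod_real_complex => /(_ isT).
rewrite ger0_norm ?invr_ge0 ?(ltW s0)// ler_pdivrMl// => gs.
have := H2 s; rewrite s0 sd2 => /(_ isT) gs1.
rewrite (_ : Qpol (g s) = (g s - g 0 - 2) * (g s - g 0)); last by rewrite /Qpol g0; ring.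
have cmod2 : cmod (- 2 : C) = 2.
  by rewrite /cmod normrN normr_nat -(rmorph_nat (real_complex R)).
rewrite cmodM -mulrA [c * s]mulrC ler_pM ?cmod_ge0//.
apply: le_trans (cmodD _ _) _; rewrite cmod2.
by move: gs1; lra.
Qed.

Lemma primitive_cvg0 i : (Qpol (g s) *: pullback r s) i 0 @[s --> 0^'+] --> (0 : C).
Proof.
have [c1 [d1 [c10 /andP[d1p d11] H1]]] := pullback_bound r_homogeneous.
have [c2 [d2 [c20 /andP[d2p d21] H2]]] := Qpol_path_bound.
have pow0 : c2 * c1 * s `^ (beta + 1) @[s --> 0^'+] --> (0 : R).
  have : c2 * c1 * s `^ (beta + 1) @[s --> 0^'+] --> c2 * c1 * 0.
    apply: cvgM; first exact: cvg_cst.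
    by apply: powR_cvg0; rewrite -ltrBlDr sub0r.
  by rewrite mulr0.
have bound : \forall s \near (0 : R)^'+,
    cmod ((Qpol (g s) *: pullback r s) i 0) <= c2 * c1 * s `^ (beta + 1).
  near=> s; have s0 : 0 < s by near: s; exact: nbhs_right_gt.
  have sd1 : s <= d1 by near: s; exact: nbhs_right_le.
  have sd2 : s <= d2 by near: s; exact: nbhs_right_le.
  rewrite mxE cmodM powRD; last by rewrite (gt_eqF s0) implybT.
  rewrite powRr1 ?(ltW s0)// (_ : _ * _ * _ = c2 * s * (c1 * s `^ beta)); last by ring.
  by rewrite ler_pM ?cmod_ge0// ?H2 ?H1 ?s0.
have sq (h : R -> R) : (\forall s \near (0 : R)^'+, `|h s| <= c2 * c1 * s `^ (beta + 1)) ->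
    h s @[s --> 0^'+] --> (0 : R).
  move=> hb; apply/norm_cvg0P; apply: (squeeze_cvgr _ (cvg_cst 0) pow0).
  by apply: filterS hb => s ->; rewrite normr_ge0.
apply/cvg_complexP; split; apply: sq; apply: filterS bound => s; apply: le_trans.
- exact: normr_Re_le.
- exact: normr_Im_le.
Unshelve. all: by end_near. Qed.

(** The fundamental theorem of calculus for Q Y~^-1 (P_k q)(Y~ v), which tends
    to 0 at -1. *)
Theorem integral_along :
  integral_rhs Y g k (Peval q) w (evalmx r (g 1) e w).
Proof.
pose u s := velocity g s *: pullback r' s; pose U s := Qpol (g s) *: pullback r s.
have uE s : 0 < s <= 1 -> integrand Y g k.+1 (Peval q) w s = u s.
  by move=> s01; exact: integrand_along.
have [c1 [d1 [c10 /andP[d1p d11] H1]]] := pullback_bound r'_homogeneous.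
have [c2 [d2 [c20 /andP[d2p d21] H2]]] := velocity_bound.
pose delta := Num.min d1 d2.
have d01 : 0 < delta <= 1 by rewrite lt_min d1p d2p ge_min d11.
have ub s i : 0 < s <= delta -> cmod (u s i 0) <= c2 * c1 * s `^ beta.
  move=> /andP[s0]; rewrite le_min => /andP[sd1 sd2].
  by rewrite mxE cmodM -mulrA ler_pM ?cmod_ge0// ?H2 ?H1 ?s0.
have uc s i : 0 < s <= 1 -> {for s, continuous (fun t => u t i 0)}.
  move=> s01; have [_ _ _ [_ vc] _] := gpath.
  rewrite (_ : (fun t => _) = fun t => velocity g t * pullback r' t i 0); last first.
    by apply/funext => t; rewrite mxE.
  by apply: cvgM; [exact: vc|exact: pullback_continuous].
have Ud s i : 0 < s <= 1 -> has_cderiv (fun t => U t i 0) s (u s i 0).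
  by move=> s01; exact: primitive_cderiv.
have part (P : C -> R) : (forall (s : R) i, 0 < s <= 1 -> is_derive s 1 (fun t => P (U t i 0)) (P (u s i 0))) ->
    (forall z, `|P z| <= cmod z) -> (forall (s : R) i, 0 < s <= 1 -> {for s, continuous (fun t => P (u t i 0))}) ->
    (forall i, P (U s i 0) @[s --> 0^'+] --> (0 : R)) ->
    forall i, lebesgue_measure.-integrable `]0, 1]
        (EFin \o (fun s => P (integrand Y g k.+1 (Peval q) w s i 0))) /\
      \int[lebesgue_measure]_(s in `]0, 1]) P (integrand Y g k.+1 (Peval q) w s i 0) = P (U 1 i 0).
  move=> PU Ple Pc P0 i.
  apply: (@eq_integral01 _ (fun s => P (u s i 0))); first by move=> s s01; rewrite uE.
  apply: (improper_FTC (U := fun s => P (U s i 0)) beta_gt d01 (c := c2 * c1)).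
  - by move=> s s01; exact: Pc.
  - by move=> s s0d; exact: le_trans (Ple _) (ub s i s0d).
  - exact: P0.
have UdP s i (s01 : 0 < s <= 1) := (has_cderivP _ _ _).1 (Ud s i s01).
have ucR s i : 0 < s <= 1 -> {for s, continuous (fun t => Re (u t i 0))}.
  by move=> s01; have /cvg_complexP[] := uc s i s01.
have ucI s i : 0 < s <= 1 -> {for s, continuous (fun t => Im (u t i 0))}.
  by move=> s01; have /cvg_complexP[] := uc s i s01.
have U0R i : Re (U s i 0) @[s --> 0^'+] --> (0 : R).
  by have /cvg_complexP[] := @primitive_cvg0 i.
have U0I i : Im (U s i 0) @[s --> 0^'+] --> (0 : R).
  by have /cvg_complexP[] := @primitive_cvg0 i.
have pR := part (@Re R) (fun s i s01 => proj1 (UdP s i s01)) (@normr_Re_le R) ucR U0R.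
have pI := part (@Im R) (fun s i s01 => proj2 (UdP s i s01)) (@normr_Im_le R) ucI U0I.
split; first by move=> i; split; [case: (pR i)|case: (pI i)].
have -> : integral01 (integrand Y g k.+1 (Peval q) w) = U 1.
  apply/matrixP => i j; rewrite mxE ord1 (pR i).2 (pI i).2.
  by case: (U 1 i 0).
have one1 : 0 < (1 : R) <= 1 by rewrite ltr01 lexx.
have [g1 gN1] := path_neq one1.
have Yu : Y 1 (g 1) \in unitmx by case: (fundamental_along one1) => /nbhs_singleton.
rewrite /U /pullback solution_alongE// -scalemxAr scalerA mulVf ?Qpol_neq0// scale1r.
by rewrite !mulmxA mulmxV// !mul1mx.
Qed.

End IntegralAlongPath.

(** * Extreme exponents at the singular point *)

Section ExponentGap.
Context {R : realType} {d n : nat}.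
Local Notation C := R[i].
Local Notation Re := complex.Re.
Context (A B : 'M[C]_d) (d0 : (0 < d)%N) (n1 : (1 < n)%N).

(** The exponents m.mu - mu_j with all weight on a single index bound the
    extreme real parts of the eigenvalues. *)
Lemma convergent_gap : convergent_at_m1 n B -> exists a b : R,
  [/\ forall z, eigenvalue B z -> a <= Re z, forall z, eigenvalue B z -> Re z <= b &
      0 < n%:R * a - b].
Proof.
move=> [mu [muB mupos]].
have eigP z : eigenvalue B z -> exists i, z = mu i.
  rewrite eigenvalue_root_char muB rootE horner_prod => /prodf_eq0[i _].
  by rewrite hornerXsubC subr_eq0 => /eqP ->; exists i.
pose i0 : 'I_d := Ordinal d0.
case: (@arg_minP _ _ _ i0 xpredT (fun i => Re (mu i)) isT) => i _ imin.
case: (@arg_maxP _ _ _ i0 xpredT (fun i => Re (mu i)) isT) => j _ jmax.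
exists (Re (mu i)), (Re (mu j)); split.
- by move=> z /eigP[l ->]; exact: imin.
- by move=> z /eigP[l ->]; exact: jmax.
have := mupos (fun l => if l == i then n else 0%N) j.
rewrite (bigD1 i)//= eqxx big1 ?addn0; last by move=> l /negbTE ->.
move=> /(_ erefl); rewrite (bigD1 i)//= eqxx big1 ?addr0; last first.
  by move=> l /negbTE ->; rewrite mul0r.
by rewrite mulr_natl raddfB raddfMn /= mulr_natl.
Qed.

(** Adding e I to B translates the real parts of the eigenvalues by Re e, which
    increases n a - b by (n - 1) Re e. *)
Lemma shift_gap : exists c : R, forall e : C, c < Re e -> exists a b : R,
  [/\ forall z, eigenvalue (B + e%:M) z -> a <= Re z,
      forall z, eigenvalue (B + e%:M) z -> Re z <= b & 0 < n%:R * a - b].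
Proof.
have [r rP] := eigenvalue_seq B.
pose rho : R := \sum_(z <- r) cmod z.
have rhoP z : eigenvalue B z -> `|Re z| <= rho.
  rewrite rP => zr; apply: le_trans (normr_Re_le z) _.
  rewrite /rho (big_rem z)//= lerDl; apply: sumr_ge0 => y _; exact: cmod_ge0.
have n10 : 0 < n%:R - 1 :> R by rewrite subr_gt0 ltr1n.
exists ((n%:R + 1) * rho / (n%:R - 1)) => e; rewrite ltr_pdivrMr// => ce.
have shiftP z : eigenvalue (B + e%:M) z -> `|Re z - Re e| <= rho.
  rewrite -{1}[e]opprK raddfN => /eigenvalue_subr_scalar /rhoP.
  by rewrite raddfB.
exists (Re e - rho), (Re e + rho); split.
- by move=> z /shiftP; rewrite ler_norml => /andP[? ?]; lra.
- by move=> z /shiftP; rewrite ler_norml => /andP[? ?]; lra.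
by move: ce; rewrite mulrDl mul1r mulrBr mulr1 mulrBr [Re e * _]mulrC; lra.
Qed.

End ExponentGap.

Theorem mainTheorem5 (R : realType) (d n : nat) (A B : 'M[R[i]]_d)
    (lam : 'I_d -> R[i]) (d_ge1 : (1 <= d)%N) (n_ge2 : (2 <= n)%N)
    (diagAB : diagonalizable (A + B)) (eigAB : eigenvalues_of (A + B) lam)
    (nonres : nonresonant lam) (k : nat) (q : @Pspace R d n) :
  (* integral relation, convergent case *)
  (convergent_at_m1 n B ->
   forall (x : R[i]) (w : 'cV[R[i]]_d) (g : R -> R[i])
          (Y : R[i] -> 'M[R[i]]_d) (Yt : R -> R[i] -> 'M[R[i]]_d),
     path_from_m1 g x ->
     fundamental_near (Msys A B) x Y ->
     continued_along (Mtilde A B n) g Yt ->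
     integral_rhs Yt g k (Peval q) w (Pop Y k x (Peval q) w)) /\
  (* integral relation, general case *)
  (forall (x : R[i]) (w : 'cV[R[i]]_d) (g : R -> R[i])
          (Y : R[i] -> 'M[R[i]]_d),
     path_from_m1 g x ->
     fundamental_near (Msys A B) x Y ->
     continued_integral_rhs A B n g k (Peval q) w (Pop Y k x (Peval q) w)) /\
  (* differential form and operator form *)
  (forall (x : R[i]) (w : 'cV[R[i]]_d) (Y Yt : R[i] -> 'M[R[i]]_d),
     x != 1 -> x != -1 ->
     fundamental_near (Msys A B) x Y ->
     fundamental_near (Mtilde A B n) x Yt ->
     [/\ derivable (fun t : R[i] => Pop Y k t (Peval q) w) x 1,
         differentiable (Pop Y k x (Peval q)) w,
         derive1 (fun t : R[i] => Pop Y k t (Peval q) w) x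
         + 'd (Pop Y k x (Peval q)) w (Msys A B x *m w)
         - Msys A B x *m Pop Y k x (Peval q) w
         = (Qpol x)^-1 *: Pop Yt k.+1 x (Peval q) w
       & x *: Dop (A + B) (Pop Y k x (Peval q)) w
         + Dop (A - B) (Pop Y k x (Peval q)) w
         + Qpol x *: derive1 (fun t : R[i] => Pop Y k t (Peval q) w) x
         = Pop Yt k.+1 x (Peval q) w]).
Proof.
have B0 : B = B + 0%:M by rewrite -scalemx1 scale0r addr0.
have one1 : 0 < (1 : R) <= 1 by rewrite ltr01 lexx.
have PE (x : R[i]) w (g : R -> R[i]) Y : path_from_m1 g x -> fundamental_near (Msys A B) x Y ->
    x = g 1 /\ Pop Y k x (Peval q) w =
    evalmx (rodrigues (coef_poly A B) k (lift_vars (fun i => mpoly.mpoly_of_dhomog (q i))) k) x 0 w.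
  move=> gpath Yf; have [_ g1x _ _ _] := gpath; split=> //.
  have [] := path_neq gpath one1; rewrite g1x => x1 xN1.
  by apply: Pop_Msys; [exact: x1|exact: xN1|rewrite -B0; exact: Yf].
split; [|split].
- move=> /(convergent_gap d_ge1)[a [b [age bge ab]]] x w g Y Yt gpath Yf Ytc.
  have [xE ->] := PE x w g Y gpath Yf; rewrite xE.
  rewrite B0 in Ytc age bge.
  exact: (integral_along d_ge1 n_ge2 gpath Ytc q k w age bge ab).
- move=> x w g Y gpath Yf; have [xE PxE] := PE x w g Y gpath Yf.
  exists (fun e => evalmx (rodrigues (coef_poly A B) k
    (lift_vars (fun i => mpoly.mpoly_of_dhomog (q i))) k) x e w); split.
  + by move=> e; have [] := is_derive_evalmx_e (rodrigues (coef_poly A B) k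
      (lift_vars (fun i => mpoly.mpoly_of_dhomog (q i))) k) x e w.
  + have [c cP] := shift_gap B n_ge2; exists c => e Yt /cP[a [b [age bge ab]]] Ytc.
    by rewrite xE; exact: (integral_along d_ge1 n_ge2 gpath Ytc q k w age bge ab).
  + by rewrite PxE.
- move=> x w Y Yt; exact: differential_relation.
Qed.
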